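(* Let $1<p<\infty$. If $0<\alpha<1$, then $L^{\alpha,p}\hookrightarrow M^{\alpha,p}$. If $\alpha\ge1$, then $L^{\alpha,p}\hookrightarrow M^{\beta,p}$ for all $0<\beta<1$.
   Context: Setting: $(X,d,m)$ is a metric space with a Borel measure $m$ such that $m(X)=\infty$ and, for some $N>0$ (Ahlfors $N$-regularity), $c^{-1}r^N\le m(B(x,r))\le c\,r^N$ for all $x\in X$, $r>0$, with $c$ independent of $x,r$. Approximation of the identity: fix a non-negative decreasing $C^\infty$ function $h:[0,\infty)\to\mathbb{R}$ with $h\equiv1$ on $[0,1/2]$ and $h\equiv0$ on $[2,\infty)$. For $t>0$ let $T_tf(x)=t^{-N}\int_X h(d(x,y)/t)f(y)\,dm(y)$, $\varphi(x,t)=1/T_t1(x)$, $\psi(x,t)=1/T_t\left(\frac{1}{T_t1}\right)(x)$, and $$s(x,y,t)=\frac{\varphi(x,t)\varphi(y,t)}{t^{2N}}\int_X h\left(\tfrac{d(x,z)}{t}\right)h\left(\tfrac{d(y,z)}{t}\right)\psi(z,t)\,dm(z).$$ Bessel potential: for $\alpha>0$, $k_\alpha(x,y)=\alpha\int_0^\infty\frac{t^\alpha}{(1+t^\alpha)^2}s(x,y,t)\frac{dt}{t}$ and $J_\alpha g(x)=\int_X g(z)k_\alpha(x,z)\,dm(z)$; $J_\alpha$ is a contraction on $L^p$, $1\le p\le\infty$. Potential space: $L^{\alpha,p}=J_\alpha(L^p)$ with norm $\|f\|_{\alpha,p}=\|f\|_p+\inf\{\|g\|_p: g\in L^p,\ J_\alpha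 g=f\}$. Hajłasz–Sobolev spaces: a nonnegative $g$ is a $\beta$-Hajłasz gradient of $f$ if $|f(x)-f(y)|\le d(x,y)^\beta(g(x)+g(y))$ for a.e. $x,y$. $M^{\beta,p}$ is the space of $f\in L^p$ having a $\beta$-Hajłasz gradient in $L^p$, with norm $\|f\|_p+\inf_g\|g\|_p$, the infimum over all $\beta$-Hajłasz gradients of $f$. $A\hookrightarrow B$ means $A\subset B$ with continuous inclusion. *)

(* Defs.v *)
From HB Require Import structures.
From mathcomp Require Import all_boot all_order all_algebra.
From mathcomp Require Import all_classical all_reals all_analysis.

Set Implicit Arguments.
Unset Strict Implicit.
Unset Printing Implicit Defensive.

Import Order.TTheory GRing.Theory Num.Theory.
Import numFieldNormedType.Exports.

Local Open Scope classical_set_scope.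
Local Open Scope ring_scope.

(* The two structures are unrelated here; that the measurable sets are the
   Borel sets is the separate condition [borel_sigma_algebra]. *)
#[short(type="metricMeasurableType")]
HB.structure Definition MetricMeasurable (R : numDomainType)
    (d : measure_display) :=
  { T of Metric R T & Measurable d T }.

Section Setting.
Context (R : realType) (d : measure_display) (X : metricMeasurableType R d).

Definition borel_sigma_algebra : Prop :=
  @measurable d X = <<s [set U : set X | open U] >>.

Definition ahlfors_regular (m : {measure set X -> \bar R}) (N c : R) : Prop :=
  forall (x : X) (r : R), 0 < r ->
    ((c^-1 * r `^ N)%:E <= m (ball x r) <= (c * r `^ N)%:E)%E.

End Setting.

(* A function on [0, +oo[ is represented by a function on R of which only the
   values on [0, +oo[ matter.  Derivatives are taken at x > 0 only: near 0
   (from the right) h is constant, so smoothness at 0 is automatic. *)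
Definition cutoff (R : realType) (h : R -> R) : Prop :=
  [/\ forall x, 0 <= x -> 0 <= h x,
      forall x y, 0 <= x -> x <= y -> h y <= h x,
      forall (n : nat) x, 0 < x -> derivable (derive1n n h) x 1,
      forall x, 0 <= x <= 2^-1 -> h x = 1
    & forall x, 2 <= x -> h x = 0].

Section Potential.
Context (R : realType) (d : measure_display) (X : metricMeasurableType R d).
Variables (m : {measure set X -> \bar R}) (N : R) (h : R -> R).

Definition approx_op (t : R) (f : X -> R) (x : X) : R :=
  t `^ (- N) * \int[m]_y (h (mdist x y / t) * f y).

Definition phi (x : X) (t : R) : R := (approx_op t (cst 1) x)^-1.

Definition psi (x : X) (t : R) : R :=
  (approx_op t (fun y => (approx_op t (cst 1) y)^-1) x)^-1.

Definition approx_kernel (x y : X) (t : R) : R :=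
  phi x t * phi y t / t `^ (2 * N) *
  \int[m]_z (h (mdist x z / t) * h (mdist y z / t) * psi z t).

(* Extended-real valued: k_alpha(x, x) = +oo when alpha <= N. *)
Definition bessel_kernel (alpha : R) (x y : X) : \bar R :=
  (alpha%:E * \int[lebesgue_measure]_(t in `]0%R, +oo[)
     (t `^ alpha / (1 + t `^ alpha) ^+ 2 * approx_kernel x y t / t)%:E)%E.

Definition bessel_potential (alpha : R) (g : X -> R) (x : X) : \bar R :=
  (\int[m]_z ((g z)%:E * bessel_kernel alpha x z))%E.

(* Elements of the function spaces below are represented by measurable
   functions X -> R; equalities between them hold m-almost everywhere. *)
Definition potential_of (alpha p : R) (f g : X -> R) : Prop :=
  g \in Lfun m p%:E /\ {ae m, forall x, bessel_potential alpha g x = (f x)%:E}.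

Definition potential_space (alpha p : R) : set (X -> R) :=
  [set f | measurable_fun setT f /\ exists g, potential_of alpha p f g].

Definition potential_norm (alpha p : R) (f : X -> R) : \bar R :=
  ('N[m]_(p%:E)[EFin \o f] +
   ereal_inf [set 'N[m]_(p%:E)[EFin \o g] | g in potential_of alpha p f])%E.

End Potential.

Section Hajlasz.
Context (R : realType) (d : measure_display) (X : metricMeasurableType R d).
Variable m : {measure set X -> \bar R}.

(* "For a.e. x, y" means: for all x, y outside a single m-null set. *)
Definition hajlasz_gradient (beta : R) (f g : X -> R) : Prop :=
  [/\ measurable_fun setT g, forall x, 0 <= g x
    & exists2 E : set X, m.-negligible E & forall x y, ~ E x -> ~ E y ->
        `|f x - f y| <= mdist x y `^ beta * (g x + g y)].

Definition hajlasz_space (beta p : R) : set (X -> R) :=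
  [set f | f \in Lfun m p%:E /\
           exists2 g, hajlasz_gradient beta f g & g \in Lfun m p%:E].

Definition hajlasz_norm (beta p : R) (f : X -> R) : \bar R :=
  ('N[m]_(p%:E)[EFin \o f] +
   ereal_inf [set 'N[m]_(p%:E)[EFin \o g] | g in hajlasz_gradient beta f])%E.

End Hajlasz.

Definition continuously_embedded (R : realType) (T : Type)
    (A : set (T -> R)) (normA : (T -> R) -> \bar R)
    (B : set (T -> R)) (normB : (T -> R) -> \bar R) : Prop :=
  A `<=` B /\
  forall f, A f -> forall e : R, 0 < e -> exists2 delta : R, 0 < delta &
    forall g, A g -> (normA (fun x => g x - f x)%R < delta%:E)%E ->
      (normB (fun x => g x - f x)%R < e%:E)%E.

(* Main.v *)
Require Import Defs.
From HB Require Import structures.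
From mathcomp Require Import all_boot all_order all_algebra.
From mathcomp Require Import all_classical all_reals all_analysis.
From mathcomp Require Import measurable_realfun ring lra.

Set Implicit Arguments.
Unset Strict Implicit.
Unset Printing Implicit Defensive.

Import Order.TTheory GRing.Theory Num.Theory.
Import numFieldNormedType.Exports.

Local Open Scope classical_set_scope.
Local Open Scope ring_scope.

(* If f = J_alpha g, a multiple of the Hardy-Littlewood maximal function M g is
   a Hajlasz gradient of f, and M is bounded on L^p for p > 1.  The kernel
   s(x, z, t) is O(t^-N) and vanishes for d(x, z) >= 4 t, and
   s(x, z, t) - s(y, z, t) gains the factor min(1, d(x, y) / t).  Integrating
   against |g| in z gives
     |J g(x) - J g(y)| <= K (M g(x) + M g(y)) \int_0^oo omega(t) min(1, d(x, y) / t) dt / t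
   with omega(t) = t^alpha / (1 + t^alpha)^2 <= t^beta for 0 < beta <= alpha, and
   for beta < 1 the integral is at most a constant times d(x, y)^beta.  In the
   same way |J g| <= K (M g) \int_0^oo omega(t) dt / t, so f is in L^p. *)

(** * Integrals of powers *)

(** The two halves of the theorem are one estimate, for [0 < beta < 1] and [beta <= alpha]. The
    second condition serves t near 0; [beta < 1] makes t^(beta - 1) d(x, y) / t integrable at
    infinity, which is why alpha >= 1 stops short of exponent 1. The obstacle is that
    [bessel_kernel] may be [+oo] while g has no sign, so kernels are never subtracted. The potential
    is rewritten as an iterated integral of one real integrand in (z, t). Where M g is finite this
    integrand is absolutely integrable on the product, so Fubini applies and differences are taken
    before any integration. The points where M g is infinite, together with those where f differs
    from J g, form the exceptional null set of the gradient. Fubini in turn asks for joint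
    measurability of s in (z, t), which comes from measurability in z and continuity in t. The bound
    on M rests on a greedy covering by balls, a weak-type bound for truncations of g and the
    layer-cake formula. *)

Lemma ge0_integral_bigcup_le d (T : measurableType d) (R : realType)
    (mu : {measure set T -> \bar R}) (F : (set T)^nat) (f : T -> \bar R) (M : \bar R) :
  {homo F : n m / (n <= m)%N >-> (n <= m)%O} ->
  (forall i, measurable (F i)) -> measurable_fun [set: T] f ->
  (forall x, (0 <= f x)%E) ->
  (forall i, (\int[mu]_(x in F i) f x <= M)%E) ->
  (\int[mu]_(x in \bigcup_i F i) f x <= M)%E.
Proof.
move=> ndF mF mf f0 FM.
have cvgF : (\int[mu]_(x in F i) f x)%E @[i --> \oo] -->
    (\int[mu]_(x in \bigcup_i F i) f x)%E.
  apply: ge0_nondecreasing_set_cvg_integral => //.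
  - by move=> i; exact: measurable_funTS.

rewrite -(cvg_lim _ cvgF)//; apply: lime_le; first by apply/cvg_ex; eexists; exact: cvgF.
by apply: nearW => n; exact: FM.
Qed.

Section integral_powR.
Context (R : realType).
Implicit Types a b e r v t : R.

Lemma powRB1E a t : 0 < t -> t `^ (a - 1) = t `^ a / t.
Proof.
move=> t0; rewrite powRD; last by rewrite (gt_eqF t0) implybT.
by rewrite powR_inv1// ltW.
Qed.

Lemma measurable_powR_EFin a (A : set R) : measurable_fun A (fun t => (t `^ a)%:E).
Proof. by apply/measurable_EFinP; apply: measurable_funTS; exact: measurable_powR. Qed.

(** Any nonzero exponent is allowed because both ends are needed: positive [a] near 0, negative [a]
    near infinity. *)
Lemma integral_powR_cc a e v : a != 0 -> 0 < e -> e < v ->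
  (\int[lebesgue_measure]_(t in `[e, v]) (t `^ (a - 1))%:E =
   ((v `^ a - e `^ a) / a)%:E)%E.
Proof.
move=> a0 e0 ev.
have dF (x : R) : 0 < x -> is_derive x 1 (fun t => a^-1 * t `^ a) (x `^ (a - 1)).
  move=> x0; have := is_derive1_powR a x0 => H.
  apply: (is_derive_eq (is_deriveZ a^-1 H)).
  by rewrite /GRing.scale/= mulrA mulVf// mul1r.
have cF (x : R) : 0 < x -> {for x, continuous (fun t : R => a^-1 * t `^ a)}.
  move=> x0; apply/differentiable_continuous; apply/derivable1_diffP.
  by have [] := dF x x0.
rewrite (@continuous_FTC2 _ _ (fun t => a^-1 * t `^ a))//.
- by rewrite -EFinB -mulrBr mulrC.
- apply: derivable_within_continuous => x; rewrite in_itv/= => /andP[ex _].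
  by apply: derivable_powR; rewrite in_itv/= andbT (lt_le_trans e0).
- split.
  + move=> x; rewrite in_itv/= => /andP[ex _].
    by have [] := dF x (lt_trans e0 ex).
  + by apply: cvg_at_right_filter; exact: cF.
  + by apply: cvg_at_left_filter; apply: cF; exact: lt_trans ev.
- move=> x; rewrite in_itv/= => /andP[ex _].
  by rewrite derive1E; have [_ ->] := dF x (lt_trans e0 ex).
Qed.

Lemma integral_powR_0oo a v : 0 < a -> 0 <= v ->
  (\int[lebesgue_measure]_(t in `]0%R, v[) (t `^ (a - 1))%:E = (v `^ a / a)%:E)%E.
Proof.
move=> a0; rewrite le_eqVlt => /predU1P[<-|v0].
  rewrite set_itv_ge ?bnd_simp ?ltxx// integral_set0 powR0 ?gt_eqF// mul0r//.
have cc e : 0 < e -> e < v ->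
    (\int[lebesgue_measure]_(t in `[e, v[) (t `^ (a - 1))%:E =
      ((v `^ a - e `^ a) / a)%:E)%E.
  move=> e0 ev.
  rewrite -integral_powR_cc ?gt_eqF//.
  by rewrite (integral_itv_bndoo true true) ?(integral_itv_bndoo true false)//;
    exact: measurable_powR_EFin.
apply/eqP; rewrite eq_le; apply/andP; split.
  rewrite itv_open_bnd_bigcup; apply: ge0_integral_bigcup_le.
  - move=> n k nk; rewrite subsetEset; apply: subset_itvr.
    by rewrite bnd_simp !add0r lef_pV2 ?posrE// ler_nat ltnS.
  - by move=> i; exact: measurable_itv.
  - exact: measurable_powR_EFin.
  - by move=> x; rewrite lee_fin powR_ge0.
  - move=> i; rewrite add0r; have [vi|iv] := leP v i.+1%:R^-1.
      rewrite set_itv_ge ?bnd_simp -?leNgt// integral_set0 lee_fin.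
      by rewrite divr_ge0 ?powR_ge0// ltW.
    by rewrite cc// lee_fin ler_pM2r ?invr_gt0// gerBl powR_ge0.
apply/lee_addgt0Pr => eps eps0.
(* Cutting off at [e] loses e^a / a, so [e] is chosen with e^a <= a * eps. *)
pose e := Num.min (v / 2) ((a * eps) `^ a^-1).
have e0 : 0 < e by rewrite lt_min divr_gt0//= powR_gt0// mulr_gt0.
have ev : e < v by rewrite gt_min ltr_pdivrMr// ltr_pMr// ltr1n.
have eE : e `^ a <= a * eps.
  apply: (@le_trans _ _ (((a * eps) `^ a^-1) `^ a)).
    apply: ge0_ler_powR; rewrite ?nnegrE ?powR_ge0 ?(ltW a0) ?(ltW e0)//.
    by rewrite ge_min lexx orbT.
  by rewrite -powRrM mulVf ?gt_eqF// powRr1// mulr_ge0// ltW.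
apply: (@le_trans _ _ ((\int[lebesgue_measure]_(t in `[e, v[) (t `^ (a - 1))%:E) + eps%:E)%E).
  rewrite cc// -EFinD lee_fin mulrBl -lerBlDl opprD opprK addrA subrr add0r.
  by rewrite ler_pdivrMr// mulrC.
rewrite leeD2r//; apply: ge0_subset_integral => //.
- exact: measurable_powR_EFin.
- by move=> x _; rewrite lee_fin powR_ge0.
- by apply: subset_itvr; rewrite bnd_simp.
Qed.

Lemma integral_powR_oy_le b v : 0 < b -> 0 < v ->
  (\int[lebesgue_measure]_(t in `]v, +oo[) (t `^ (- b - 1))%:E <= (v `^ (- b) / b)%:E)%E.
Proof.
move=> b0 v0; rewrite integral_itv_obnd_cbnd; last exact: measurable_powR_EFin.
rewrite itv_bndy_bigcup_BRight; apply: ge0_integral_bigcup_le.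
- move=> n k nk; rewrite subsetEset; apply: subset_itvl.
  by rewrite bnd_simp lerD2l ler_nat.
- by move=> i; exact: measurable_itv.
- exact: measurable_powR_EFin.
- by move=> x; rewrite lee_fin powR_ge0.
(* At index 0 the exhausting interval is the single point v. *)
- move=> [|i].
    rewrite addr0 set_itv1 integral_set1 lee_fin.
    by rewrite divr_ge0 ?powR_ge0// ltW.
  rewrite integral_powR_cc ?lt_eqF ?oppr_lt0 ?ltrDl// lee_fin.
  by rewrite invrN mulrN -mulNr opprB ler_pM2r ?invr_gt0// gerBl powR_ge0.
Qed.

(** Writing x^-1 as x * (x^2)^-1 reduces negative x to a power of a nonnegative number; at 0 both
    sides are 0. *)
Lemma measurable_inv (A : set R) : measurable_fun A (fun x : R => x^-1).
Proof.
have -> : (fun x : R => x^-1) = (fun x => x * ((x ^+ 2) `^ (- 1))).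
  apply/funext => x; rewrite powR_inv1 ?sqr_ge0//.
  have [->|x0] := eqVneq x 0; first by rewrite invr0 mul0r.
  by rewrite expr2 invfM mulrA mulfV// mul1r.
apply: measurable_funM => //; apply: (measurableT_comp (measurable_powR _)).
exact: measurable_funX.
Qed.

Lemma measurable_powR_min a b r (A : set R) :
  measurable_fun A (fun t => (t `^ (a - 1) * Num.min 1 ((r / t) `^ b))%:E).
Proof.
apply/measurable_EFinP; apply: measurable_funTS.
apply: measurable_funM; first exact: measurable_powR.
apply: measurable_minr => //.
apply: (measurableT_comp (measurable_powR _)).
by apply: measurable_funM => //; exact: measurable_inv.
Qed.

(** The integral splits at t = r: below, the minimum is at most 1 and [0 < a] gives convergence at
    0; above, it is at most (r / t)^b and [a < b] gives convergence at infinity. *)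
Lemma integral_powR_min_le a b r : 0 < a -> a < b -> 0 < r ->
  (\int[lebesgue_measure]_(t in `]0%R, +oo[)
     (t `^ (a - 1) * Num.min 1 ((r / t) `^ b))%:E <=
   ((a^-1 + (b - a)^-1) * r `^ a)%:E)%E.
Proof.
move=> a0 ab r0.
have f0 t : 0 <= t `^ (a - 1) * Num.min 1 ((r / t) `^ b).
  by rewrite mulr_ge0 ?powR_ge0// le_min ler01 powR_ge0.
have -> : `]0%R, +oo[%classic = `]0%R, r] `|` `]r, +oo[ :> set R.
  by rewrite -itv_bndbnd_setU ?bnd_simp// ltW.
rewrite ge0_integral_setU//=; last 3 first.
- exact: measurable_powR_min.
- by move=> x _; rewrite lee_fin.
- apply/disj_setPS => x [/=]; rewrite !in_itv/= => /andP[_ xr].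
  by rewrite andbT ltNge xr.
rewrite mulrDl EFinD; apply: leeD.
  rewrite integral_itv_bndoo; last exact: measurable_powR_min.
  rewrite mulrC -integral_powR_0oo ?(ltW r0)//.
  apply: ge0_le_integral => //.
  - by move=> x _; rewrite lee_fin.
  - exact: measurable_powR_min.
  - exact: measurable_powR_EFin.
  - move=> x _; rewrite lee_fin ler_piMr ?powR_ge0//.
apply: (@le_trans _ _ (\int[lebesgue_measure]_(t in `]r, +oo[)
    ((r `^ b)%:E * (t `^ (- (b - a) - 1))%:E))%E).
  apply: ge0_le_integral => //.
  - by move=> x _; rewrite lee_fin.
  - exact: measurable_powR_min.
  - apply/measurable_EFinP; apply: measurable_funM => //.
    exact: measurable_funTS (measurable_powR _).
  - move=> x; rewrite /= in_itv/= andbT => rx; have x0 := lt_trans r0 rx.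
    rewrite -EFinM lee_fin; apply: (@le_trans _ _ (x `^ (a - 1) * (r / x) `^ b)).
      by apply: ler_wpM2l; rewrite ?powR_ge0// ge_min lexx orbT.
    rewrite powRM ?invr_ge0 ?(ltW r0) ?(ltW x0)// mulrCA.
    apply: ler_wpM2l; first by rewrite powR_ge0.
    rewrite -powR_inv1 ?(ltW x0)// -powRrM -powRD; last by rewrite (gt_eqF x0) implybT.
    by rewrite (_ : a - 1 + -1 * b = - (b - a) - 1)//; ring.
rewrite ge0_integralZl//; last 3 first.
- exact: measurable_powR_EFin.
- by move=> x _; rewrite lee_fin powR_ge0.
- by rewrite lee_fin powR_ge0.
apply: (@le_trans _ _ ((r `^ b)%:E * (r `^ (- (b - a)) / (b - a))%:E)%E).
  apply: lee_wpmul2l; first by rewrite lee_fin powR_ge0.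
  by apply: integral_powR_oy_le; rewrite ?subr_gt0.
rewrite -EFinM lee_fin.
rewrite mulrA -powRD; last by rewrite (gt_eqF r0) implybT.
rewrite mulrC.
by rewrite (_ : b + - (b - a) = a)//; ring.
Qed.

End integral_powR.

(** * Covering by balls *)

Section borel.
Context (R : realType) (d : measure_display) (X : metricMeasurableType R d).
Implicit Types (x y : X) (r : R).

Lemma in_ball x r y : ball x r y = (mdist x y < r).
Proof. by rewrite ballEmdist. Qed.

Lemma open_metric_ball x r : open (ball x r).
Proof.
rewrite openE => y; rewrite in_ball => xy.
apply/nbhs_ballP; exists (r - mdist x y) => /=; first by rewrite subr_gt0.
move=> z; rewrite !in_ball => yz.
by rewrite (le_lt_trans (metric_triangle x y z))// -ltrBrDl.
Qed.

Lemma ball_sub x y r s : mdist x y + r <= s -> ball y r `<=` ball x s.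
Proof.
move=> xys z; rewrite !in_ball => yz.
by rewrite (le_lt_trans (metric_triangle x y z))// (lt_le_trans _ xys)// ltrD2l.
Qed.

Hypothesis hBorel : borel_sigma_algebra X.

Lemma open_borel (U : set X) : open U -> measurable U.
Proof. by move=> oU; rewrite hBorel; exact: sub_sigma_algebra. Qed.

Lemma measurable_metric_ball x r : measurable (ball x r).
Proof. exact/open_borel/open_metric_ball. Qed.

Lemma continuous_borel (f : X -> R) : continuous f -> measurable_fun setT f.
Proof.
move=> /continuousP cf; apply: (measurability _ (RGenOpens.measurableE R)).
move=> _ [_ [a [b ->]] <-]; rewrite setTI; apply: open_borel.
by apply: cf; exact: interval_open.
Qed.

Lemma open_superlevel_borel (f : X -> \bar R) :
  (forall a : R, open [set x | (a%:E < f x)%E]) -> measurable_fun setT f.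
Proof.
move=> of_; apply: (measurability _ (ErealGenOInfty.measurableE R)).
move=> _ [_ [a ->] <-]; rewrite setTI; apply: open_borel.
by rewrite preimage_itvoy; exact: of_.
Qed.

End borel.

Section covering.
Context (R : realType) (d : measure_display) (X : metricMeasurableType R d).
Context (m : {measure set X -> \bar R}) (N c : R).
Hypotheses (hBorel : borel_sigma_algebra X) (hN : 0 < N) (hc : 0 < c)
  (hAhlfors : ahlfors_regular m N c).

Lemma measure_ball_le (x : X) (r : R) : 0 < r -> (m (ball x r) <= (c * r `^ N)%:E)%E.
Proof. by move=> r0; have /andP[] := hAhlfors x r0. Qed.

Lemma measure_ball_ge (x : X) (r : R) : 0 < r -> ((c^-1 * r `^ N)%:E <= m (ball x r))%E.
Proof. by move=> r0; have /andP[] := hAhlfors x r0. Qed.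

Implicit Types (b : X * R) (s : seq (X * R)) (k e : R).

(** Used with k = 1 for the selected balls and with k = 5 for the dilations that must cover
    everything. *)
Let covered (k : R) s : set X := [set x | exists2 b, b \in s & ball b.1 (k * b.2) x].

Let covered_nil k : covered k [::] = set0.
Proof. by apply/seteqP; split => // x [b]. Qed.

Let covered_cons k b s : covered k (b :: s) = ball b.1 (k * b.2) `|` covered k s.
Proof.
apply/seteqP; split => x.
  move=> [b']; rewrite inE => /predU1P[->|bs] bx; first by left.
  by right; exists b'.
move=> [bx|[b' bs bx]]; first by exists b => //; rewrite mem_head.
by exists b' => //; rewrite inE bs orbT.
Qed.

Let measurable_covered k s : measurable (covered k s).
Proof.
elim: s => [|b s IH]; first by rewrite covered_nil.
by rewrite covered_cons; apply: measurableU => //; exact: measurable_metric_ball.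
Qed.

Let measure_covered k s : 0 < k -> (forall b, b \in s -> 0 < b.2) ->
  (m (covered k s) <= (c * k `^ N * \sum_(b <- s) b.2 `^ N)%:E)%E.
Proof.
move=> k0; elim: s => [_|b s IH hs].
  by rewrite covered_nil measure0 big_nil mulr0.
have b0 : 0 < b.2 by apply: hs; rewrite mem_head.
rewrite covered_cons big_cons mulrDr EFinD.
apply: (le_trans (measureU2 m _ _)) => //; first exact: measurable_metric_ball.
apply: leeD; last by apply: IH => b' bs; apply: hs; rewrite inE bs orbT.
apply: (le_trans (measure_ball_le _ (mulr_gt0 k0 b0))).
by rewrite powRM ?(ltW k0) ?(ltW b0)// mulrA.
Qed.

Variables (P : set (X * R)) (g : X -> \bar R) (K : R).
Hypotheses (mg : measurable_fun [set: X] g) (g0 : forall x, (0 <= g x)%E) (K0 : 0 < K).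
Hypothesis hP : forall b, P b ->
  0 < b.2 /\ ((K * b.2 `^ N)%:E <= \int[m]_(x in ball b.1 b.2) g x)%E.

Let int_ge0 A : (0 <= \int[m]_(x in A) g x)%E.
Proof. exact: integral_ge0. Qed.

Let int_le A : measurable A -> (\int[m]_(x in A) g x <= \int[m]_x g x)%E.
Proof. by move=> mA; exact: ge0_subset_integral. Qed.

Section fixed_scale.
Variable e : R.
Hypothesis e0 : 0 < e.
Hypothesis intg : (\int[m]_x g x < +oo)%E.

Let Pe : set (X * R) := [set b | P b /\ e <= b.2].

Let I := fine (\int[m]_x g x).

Let IE : (\int[m]_x g x)%E = I%:E.
Proof. by rewrite fineK// ge0_fin_numE. Qed.

(** Finite total mass bounds the radii, so that a nearly largest ball can be picked. *)
Let radius_bound b : Pe b -> b.2 <= (I / K) `^ N^-1.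
Proof.
move=> [/hP[b0 hb] _].
have : b.2 `^ N <= I / K.
  rewrite ler_pdivlMr// mulrC -lee_fin -IE; apply: (le_trans hb).
  by apply: int_le; exact: measurable_metric_ball.
move=> bI; rewrite -[leLHS]powRr1 ?(ltW b0)// -[X in _ `^ X](@mulfV _ N) ?gt_eqF//.
rewrite powRrM; apply: ge0_ler_powR; rewrite ?nnegrE ?powR_ge0 ?invr_ge0 ?(ltW hN)//.
exact: le_trans (powR_ge0 _ _) bI.
Qed.

(** The supremum of the radii need not be attained; settling for half of it costs the factor 2 that
    leads to the dilation 1 + 2 * 2 = 5. *)
Let largest_ball (A : set (X * R)) : A !=set0 -> A `<=` Pe ->
  exists2 b, A b & forall b', A b' -> b'.2 <= 2 * b.2.
Proof.
move=> [b0 Ab0] APe.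
have hs : has_sup (snd @` A).
  split; first by exists b0.2, b0.
  by exists ((I / K) `^ N^-1) => _ [b /APe/radius_bound + <-].
have le_sup b : A b -> b.2 <= sup (snd @` A).
  by move=> Ab; apply: ub_le_sup; [exact: hs.2|exists b].
have sup0 : 0 < sup (snd @` A).
  by apply: (lt_le_trans _ (le_sup _ Ab0)); have [_ /(lt_le_trans e0)] := APe _ Ab0.
have [_ [b Ab <-] hb] := sup_adherent (divr_gt0 sup0 (ltr0Sn R 1)) hs.
exists b => // b' /le_sup /le_trans; apply.
move: hb; rewrite {1}(splitr (sup _)) addrK => /ltW; rewrite ler_pdivrMr//.
by rewrite mulrC.
Qed.

(** Disjointness of the selected balls is recorded only through its consequence, the lower bound on
    the mass of their union. *)
Let good s := [/\ forall b, b \in s -> Pe b,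
  ((K * \sum_(b <- s) b.2 `^ N)%:E <= \int[m]_(x in covered 1 s) g x)%E &
  forall b, Pe b -> ball b.1 b.2 `&` covered 1 s = set0 \/
                    ball b.1 b.2 `<=` covered 5 s].

Let complete s := forall b, Pe b -> ball b.1 b.2 `<=` covered 5 s.

Let greedy_step s : good s ->
  good s /\ complete s \/ exists s', good s' /\ size s' = (size s).+1.
Proof.
move=> gs; have [sPe sum_s ds] := gs.
pose A : set (X * R) := [set b | Pe b /\ ball b.1 b.2 `&` covered 1 s = set0].
have [A0|nA] := pselect (A !=set0); last first.
  by left; split => // b Pb; have [bs|//] := ds b Pb; exfalso; apply: nA; exists b.
right; have [b [Pb bs] bmax] := largest_ball A0 (fun b H => H.1).
have [b0 hb] := hP Pb.1.
exists (b :: s); split => //; split.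
- by move=> b'; rewrite inE => /predU1P[->//|]; exact: sPe.
- rewrite covered_cons mul1r ge0_integral_setU//=; last 3 first.
  + exact: measurable_metric_ball.
  + exact: measurable_funTS.
  + by apply/disj_setPS; rewrite bs.
  by rewrite big_cons mulrDr EFinD leeD.
- move=> b' Pb'; have [b's|b's] := ds b' Pb'; last first.
    by right => x /b's; rewrite covered_cons; right.
  have [bb'|/set0P[x [b'x bx]]] := eqVneq (ball b'.1 b'.2 `&` ball b.1 b.2) set0.
    by left; rewrite covered_cons mul1r setIUr bb' b's setU0.
  (* [b'] was still a candidate, so its radius is at most twice that of [b]; since the two balls
     meet, [b'] lies within b.2 + 2 * b'.2 <= 5 * b.2 of the centre of [b]. *)
  right; rewrite covered_cons; apply: subset_trans (@subsetUl _ _ _).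
  apply: ball_sub; have b'b : b'.2 <= 2 * b.2 by apply: bmax.
  have := metric_triangle b.1 x b'.1; rewrite (metric_sym x).
  by move: b'x bx; rewrite !in_ball; lra.
Qed.

Let greedy_iter n :
  (exists s, good s /\ complete s) \/ exists s, good s /\ size s = n.
Proof.
elim: n => [|n [|[s [gs <-]]]]; [|by left|].
  right; exists [::]; split => //; split => //.
    by rewrite big_nil mulr0 covered_nil integral_set0.
  by move=> b _; left; rewrite covered_nil setI0.
by have [gs'|] := greedy_step gs; [left; exists s|right].
Qed.

Let good_sum s : good s -> K * \sum_(b <- s) b.2 `^ N <= I.
Proof.
by move=> [_ hs _]; rewrite -lee_fin -IE (le_trans hs)// int_le.
Qed.

(* Disjoint balls of radius at least [e] each carry mass at least [K * e `^ N],
   so a greedy selection stops. *)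
Let exists_complete : exists s, good s /\ complete s.
Proof.
have Ke : 0 < K * e `^ N by rewrite mulr_gt0// powR_gt0.
pose n := (Num.truncn (I / (K * e `^ N))).+1.
have nI : I / (K * e `^ N) < n%:R by exact: truncnS_gt.
have [//|[s [gs sn]]] := greedy_iter n.
have := good_sum gs; rewrite leNgt => /negP; case.
move: nI; rewrite ltr_pdivrMr// => /lt_le_trans; apply.
rewrite mulrCA ler_pM2l// -sn -sum1_size natr_sum big_distrl/=.
rewrite big_seq [leRHS]big_seq; apply: ler_sum => b bs; rewrite mul1r.
have [_ eb] := (let: And3 H _ _ := gs in H) b bs.
by apply: ge0_ler_powR; rewrite ?nnegrE ?(ltW hN)// ltW// (lt_le_trans e0).
Qed.

Lemma measure_bigcup_ball_scale :
  (m (\bigcup_(b in Pe) ball b.1 b.2) <= (c * 5 `^ N / K)%:E * \int[m]_x g x)%E.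
Proof.
have [s [gs cs]] := exists_complete.
apply: (@le_trans _ _ (m (covered 5 s))).
  apply: le_measure; rewrite ?inE.
  - by apply: open_borel => //; apply: bigcup_open => b _; exact: open_metric_ball.
  - exact: measurable_covered.
  - by apply: bigcup_sub => b; exact: cs.
apply: (le_trans (measure_covered _ _)) => //.
  by move=> b bs; have [/hP[]] := (let: And3 H _ _ := gs in H) b bs.
rewrite IE -EFinM lee_fin -!mulrA ler_pM2l// ler_pM2l ?powR_gt0//.
by rewrite ler_pdivlMl// good_sum.
Qed.

End fixed_scale.

(** Balls of arbitrarily small radius are reached by an increasing union over the scales
    [n.+1%:R^-1]. These unions may be uncountable, but they are open, hence Borel. *)
Lemma measure_bigcup_ball :
  (m (\bigcup_(b in P) ball b.1 b.2) <= (c * 5 `^ N / K)%:E * \int[m]_x g x)%E.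
Proof.
have C0 : 0 < c * 5 `^ N / K by rewrite !(mulr_gt0, invr_gt0)// powR_gt0.
have [intg|] := ltP (\int[m]_x g x)%E +oo%E; last first.
  by rewrite leye_eq => /eqP ->; rewrite gt0_muley ?lte_fin// leey.
pose F n := \bigcup_(b in [set b | P b /\ n.+1%:R^-1 <= b.2]) ball b.1 b.2.
have oF n : open (F n) by apply: bigcup_open => b _; exact: open_metric_ball.
have -> : \bigcup_(b in P) ball b.1 b.2 = \bigcup_n F n.
  apply/seteqP; split => [x [b Pb bx]|x [n _ [b [Pb _] bx]]]; last by exists b.
  have [b0 _] := hP Pb.
  exists (Num.truncn b.2^-1) => //; exists b => //; split => //.
  rewrite -[leRHS]invrK lef_pV2 ?posrE ?invr_gt0// ltW//.
  exact: truncnS_gt.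
have cvgF : (m \o F) x @[x --> \oo] --> m (\bigcup_n F n).
  apply: nondecreasing_cvg_mu.
  - by move=> n; exact: open_borel.
  - by apply: bigcup_measurable => n _; exact: open_borel.
  - move=> n k nk; rewrite subsetEset; apply: bigcup_subset => b [Pb nb].
    split => //; apply: le_trans nb.
    by rewrite lef_pV2 ?posrE// ler_nat ltnS.
rewrite -(cvg_lim _ cvgF)//; apply: lime_le.
  by apply/cvg_ex; eexists; exact: cvgF.
by apply: nearW => n; apply: measure_bigcup_ball_scale; rewrite ?invr_gt0.
Qed.

End covering.

(** * The maximal function *)

Lemma integral_if d (T : measurableType d) (R : realType) (mu : {measure set T -> \bar R})
    (D : set T) (P : T -> bool) (f : T -> \bar R) : (forall x, D x <-> P x) ->
  (\int[mu]_(x in D) f x = \int[mu]_x (if P x then f x else 0))%E.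
Proof.
move=> DP; rewrite integral_mkcond; apply: eq_integral => x _; rewrite patchE.
by congr (if _ then _ else _); apply/idP/idP; rewrite inE => /DP.
Qed.

Section maximal_function.
Context (R : realType) (d : measure_display) (X : metricMeasurableType R d).
Context (m : {sigma_finite_measure set X -> \bar R}) (N c : R).
Hypotheses (hBorel : borel_sigma_algebra X) (hN : 0 < N) (hc : 0 < c)
  (hAhlfors : ahlfors_regular m N c).
Implicit Types (w : X -> R) (x y : X) (r t v : R).

(* Averages are normalised by [r `^ N], which is comparable to the measure
   of the ball. *)
Definition maximal w x : \bar R := ereal_sup
  [set ((b.2 `^ N)^-1%:E * \int[m]_(y in ball b.1 b.2) `|w y|%:E)%E |
    b in [set b : X * R | 0 < b.2 /\ ball b.1 b.2 x]].

Lemma integral_ball_le_maximal w x y r : 0 < r -> ball y r x ->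
  (\int[m]_(z in ball y r) `|w z|%:E <= (r `^ N)%:E * maximal w x)%E.
Proof.
move=> r0 yx; have rN0 : 0 < r `^ N by rewrite powR_gt0.
rewrite -lee_pdivrMl//; apply: ereal_sup_ubound.
by exists (y, r).
Qed.

Lemma maximal_ge0 w x : (0 <= maximal w x)%E.
Proof.
apply: ereal_sup_ge.
exists ((1 `^ N)^-1%:E * \int[m]_(y in ball x 1) `|w y|%:E)%E.
  by exists (x, 1) => //; split => //; exact: ballxx.
by rewrite mule_ge0 ?lee_fin ?invr_ge0 ?powR_ge0// integral_ge0// => z _; rewrite lee_fin.
Qed.

(** Here it matters that the maximal function is uncentred: every point of an admissible ball
    belongs to the superlevel set. The set is thus open, and it is already in the form that the
    covering bound takes. *)
Lemma superlevel_maximalE w (a : R) :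
  [set x | (a%:E < maximal w x)%E] =
  \bigcup_(b in [set b : X * R | 0 < b.2 /\
    ((a * b.2 `^ N)%:E < \int[m]_(y in ball b.1 b.2) `|w y|%:E)%E]) ball b.1 b.2.
Proof.
have E (b : X * R) (I : \bar R) : 0 < b.2 ->
    (a%:E < (b.2 `^ N)^-1%:E * I)%E = ((a * b.2 `^ N)%:E < I)%E.
  by move=> b0; rewrite lte_pdivlMl ?powR_gt0// -EFinM mulrC.
apply/seteqP; split => x.
  move=> /ereal_sup_gt[_ [b [b0 bx] <-]]; rewrite E// => ab.
  by exists b.
move=> [b [b0]]; rewrite -E// => /lt_le_trans ab bx; apply: ab.
by apply: ereal_sup_ubound; exists b.
Qed.

Lemma open_superlevel_maximal w (a : R) : open [set x | (a%:E < maximal w x)%E].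
Proof.
by rewrite superlevel_maximalE; apply: bigcup_open => b _; exact: open_metric_ball.
Qed.

Lemma measurable_maximal w : measurable_fun [set: X] (maximal w).
Proof.
by apply: open_superlevel_borel => // a; exact: open_superlevel_maximal.
Qed.

(** On a ball of radius R with mass above r R^N, values of |w| up to r / (2 c) contribute at most
    half of r R^N, by the upper measure bound. The truncation therefore keeps the other half, and
    the covering bound applies to it with K = r / 2. *)
Lemma maximal_weak w r : 0 < r -> measurable_fun [set: X] w ->
  (m [set x | (r%:E < maximal w x)%E] <= (2 * c * 5 `^ N / r)%:E *
    \int[m]_x (if r / (2 * c) < `|w x| then `|w x| else 0)%:E)%E.
Proof.
move=> r0 mw; set s := r / (2 * c); have s0 : 0 < s by rewrite divr_gt0// mulr_gt0.
have mabs : measurable_fun [set: X] (fun x => `|w x|) by exact: measurableT_comp.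
set g : X -> \bar R := fun x => _%:E.
have mg : measurable_fun [set: X] g.
  by apply/measurable_EFinP; apply: measurable_fun_ifT => //; exact: measurable_fun_ltr.
have g0 x : (0 <= g x)%E by rewrite lee_fin; case: ifP.
have K0 : 0 < c * s by rewrite mulr_gt0.
rewrite superlevel_maximalE.
have -> : 2 * c * 5 `^ N / r = c * 5 `^ N / (c * s).
  by rewrite /s; field; rewrite !gt_eqF.
apply: (measure_bigcup_ball hBorel hN hc hAhlfors mg g0 K0) => b [b0 hb]; split => //.
rewrite leNgt; apply/negP => gb.
move: hb; apply/negP; rewrite -leNgt.
have mb : measurable (ball b.1 b.2) by exact: measurable_metric_ball.
apply: (@le_trans _ _ (\int[m]_(y in ball b.1 b.2) (g y + s%:E))%E).
  apply: ge0_le_integral => //=.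
  - by apply/measurable_EFinP; exact: measurable_funTS.
  - by apply: measurable_funTS; exact: emeasurable_funD.
  - move=> y _; rewrite /g -EFinD lee_fin; case: ifPn => [_|]; first by rewrite lerDl ltW.
    by rewrite -leNgt add0r.
rewrite ge0_integralD//=; last 2 first.
- exact: measurable_funTS.
- by move=> y _; rewrite lee_fin ltW.
rewrite integral_cst//=.
have -> : r * b.2 `^ N = c * s * b.2 `^ N + s * (c * b.2 `^ N).
  by rewrite /s; field; rewrite gt_eqF.
rewrite EFinD; apply: leeD; first exact: ltW.
rewrite (EFinM s); apply: lee_wpmul2l; first by rewrite lee_fin ltW.
exact: (measure_ball_le hAhlfors).
Qed.

Section strong.
Variables (p : R) (w : X -> R).
Hypotheses (hp : 1 < p) (mw : measurable_fun [set: X] w).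

Let p0 : 0 < p. Proof. exact: lt_trans hp. Qed.
Let p10 : 0 < p - 1. Proof. by rewrite subr_gt0. Qed.

(** Layer-cake form of (maximal w x)^p / p. The range of t is encoded by a test, so that the
    integrand is one function on the product with the line. *)
Let layer x : \bar R := (\int[lebesgue_measure]_t
  (if (0 < t)%R && (t%:E < maximal w x)%E then (t `^ (p - 1))%:E else 0))%E.

Let layer_ge0 x : (0 <= layer x)%E.
Proof. by apply: integral_ge0 => t _; case: ifP => //; rewrite lee_fin powR_ge0. Qed.

(** Stated for every real [v] below the maximal function, so that it also speaks of points where
    that function is [+oo]. *)
Let layer_ge x v : 0 <= v -> (v%:E <= maximal w x)%E -> ((v `^ p / p)%:E <= layer x)%E.
Proof.
move=> v0 vM; rewrite -integral_powR_0oo//.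
rewrite (@integral_if _ (measurableTypeR R) R lebesgue_measure _
    (fun t => (0 < t) && (t < v))); last first.
  by move=> t; rewrite /= in_itv.
apply: ge0_le_integral => //.
- by move=> t _; case: ifP => //; rewrite lee_fin powR_ge0.
- apply: measurable_fun_ifT => //; last exact: measurable_powR_EFin.
  by apply: measurable_and; exact: measurable_fun_ltr.
- apply: measurable_fun_ifT => //; last exact: measurable_powR_EFin.
  apply: measurable_and; first exact: measurable_fun_ltr.
  by apply: measurable_fun_lte => //; exact/measurable_EFinP.
- move=> t _; case: (ltP 0 t) => //= t0; case: ltP => [tv|_].
    by rewrite (lt_le_trans _ vM)// lte_fin.
  by case: ifP => //; rewrite lee_fin powR_ge0.
Qed.

(** The weak-type constant 2 c 5^N times the factor left by integrating t^(p - 2) up to 2 c |w|. *)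
Let C : R := 2 * c * 5 `^ N * (2 * c) `^ (p - 1) / (p - 1).

Let M : \bar R := (\int[m]_x (`|w x| `^ p)%:E)%E.

Let F1 (q : X * measurableTypeR R) : \bar R :=
  if (0 < q.2) && (q.2%:E < maximal w q.1)%E then (q.2 `^ (p - 1))%:E else 0%E.

Let F2 (q : X * measurableTypeR R) : \bar R :=
  if (0 < q.2) && (q.2 / (2 * c) < `|w q.1|) then
    (q.2 `^ (p - 2) * `|w q.1|)%:E else 0%E.

Let m2 : measurable_fun [set: X * measurableTypeR R] (fun q => q.2 : R).
Proof. exact: measurable_snd. Qed.

Let mabs1 : measurable_fun [set: X * measurableTypeR R] (fun q => `|w q.1|).
Proof. by apply: measurableT_comp => //; exact: measurableT_comp. Qed.

Let mF1 : measurable_fun [set: X * measurableTypeR R] F1.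
Proof.
apply: measurable_fun_ifT => //.
- apply: measurable_and; first exact: measurable_fun_ltr.
  apply: measurable_fun_lte; first exact/measurable_EFinP.
  by apply: measurableT_comp => //; exact: measurable_maximal.
- by apply/measurable_EFinP; exact: (measurableT_comp (measurable_powR (p - 1)) m2).
Qed.

Let mF2 : measurable_fun [set: X * measurableTypeR R] F2.
Proof.
apply: measurable_fun_ifT => //.
- apply: measurable_and; first exact: measurable_fun_ltr.
  by apply: measurable_fun_ltr => //; exact: measurable_funM.
- apply/measurable_EFinP; apply: measurable_funM => //.
  exact: (measurableT_comp (measurable_powR (p - 2)) m2).
Qed.

Let F1_ge0 q : (0 <= F1 q)%E.
Proof. by rewrite /F1; case: ifP => // _; rewrite lee_fin powR_ge0. Qed.

Let F2_ge0 q : (0 <= F2 q)%E.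
Proof. by rewrite /F2; case: ifP => // _; rewrite lee_fin mulr_ge0// powR_ge0. Qed.

Let measurable_layer : measurable_fun [set: X] layer.
Proof. exact: (measurable_fun_fubini_tonelli_F (m2 := lebesgue_measure) F1). Qed.

(** This is the weak-type bound at level t; its factor 1 / t lowers the power from p - 1 to p -
    2. *)
Let slice_F1 (t : R) :
  (\int[m]_x F1 (x, t) <= (2 * c * 5 `^ N)%:E * \int[m]_x F2 (x, t))%E.
Proof.
have [t0|t0] := ltP 0 t; last first.
  rewrite integral0_eq; last by move=> x _; rewrite /F1/= ltNge t0.
  by rewrite mule_ge0 ?lee_fin ?mulr_ge0 ?powR_ge0 ?(ltW hc)// integral_ge0.
have mg : measurable_fun [set: X] (fun x => (if t / (2 * c) < `|w x| then `|w x| else 0)%:E).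
  apply/measurable_EFinP; apply: measurable_fun_ifT => //.
  - by apply: measurable_fun_ltr => //; exact: measurableT_comp.
  - exact: measurableT_comp.
have -> : (\int[m]_x F1 (x, t) =
    (t `^ (p - 1))%:E * m [set x | (t%:E < maximal w x)%E])%E.
  rewrite -integral_cst//; last first.
    by apply: open_borel => //; exact: open_superlevel_maximal.
  rewrite [RHS](@integral_if _ X R m _ (fun x => (t%:E < maximal w x)%E))//.
  by apply: eq_integral => x _; rewrite /F1/= t0.
have -> : (\int[m]_x F2 (x, t) = (t `^ (p - 2))%:E *
    \int[m]_x (if t / (2 * c) < `|w x| then `|w x| else 0)%:E)%E.
  rewrite -ge0_integralZl//; last 2 first.
  - by move=> x _; rewrite lee_fin; case: ifP.
  - by rewrite lee_fin powR_ge0.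
  by apply: eq_integral => x _; rewrite /F2/= t0/=; case: ifP; rewrite ?mule0.
apply: le_trans.
  by apply: lee_wpmul2l; [rewrite lee_fin powR_ge0|exact: (maximal_weak t0 mw)].
rewrite !muleA -!EFinM.
suff -> : t `^ (p - 1) * (2 * c * 5 `^ N / t) = 2 * c * 5 `^ N * t `^ (p - 2) by [].
rewrite mulrCA; congr (_ * _).
have -> : p - 2 = p - 1 - 1 by ring.
by rewrite (powRB1E (p - 1)).
Qed.

(** Seen from t, the truncation of |w| is the range t < 2 c |w x|. Integrability of t^(p - 2) at 0
    is where [1 < p] enters. *)
Let slice_F2 x : (\int[lebesgue_measure]_t F2 (x, t) =
  ((2 * c) `^ (p - 1) / (p - 1) * `|w x| `^ p)%:E)%E.
Proof.
have c20 : 0 < 2 * c by rewrite mulr_gt0.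
have -> : (\int[lebesgue_measure]_t F2 (x, t) = `|w x|%:E *
    \int[lebesgue_measure]_(t in `]0%R, (2 * c * `|w x|)%R[) (t `^ (p - 1 - 1))%:E)%E.
  rewrite -ge0_integralZl//; last 2 first.
  - exact: measurable_powR_EFin.
  - by move=> t _; rewrite lee_fin powR_ge0.
  rewrite [RHS](@integral_if _ (measurableTypeR R) R lebesgue_measure _
    (fun t => (0 < t) && (t < 2 * c * `|w x|))); last first.
    by move=> t; rewrite /= in_itv.
  apply: eq_integral => t _; rewrite /F2/= ltr_pdivrMr// (mulrC `|w x|).
  have -> : p - 2 = p - 1 - 1 by ring.
  by case: ifP => // _; rewrite -EFinM mulrC.
rewrite integral_powR_0oo//; last by rewrite mulr_ge0// ltW.
rewrite -EFinM powRM ?(ltW c20)//; congr (_%:E).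
by rewrite -(mulr_powRB1 (normr_ge0 (w x)) p0); ring.
Qed.

Let integral_layer : (\int[m]_x layer x <= C%:E * M)%E.
Proof.
rewrite (@fubini_tonelli _ _ _ _ _ m lebesgue_measure F1)//.
apply: (@le_trans _ _ (\int[lebesgue_measure]_t ((2 * c * 5 `^ N)%:E * \int[m]_x F2 (x, t)))%E).
  have mS2 := measurable_fun_fubini_tonelli_G (m1 := m) F2 mF2 F2_ge0.
  apply: ge0_le_integral => //.
  - by move=> t _; exact: integral_ge0.
  - exact: (measurable_fun_fubini_tonelli_G (m1 := m) F1).
  - exact: measurable_funeM.
have C0 : 0 <= 2 * c * 5 `^ N by rewrite !mulr_ge0 ?powR_ge0// ltW.
rewrite ge0_integralZl//; last 2 first.
- exact: (measurable_fun_fubini_tonelli_G (m1 := m) F2).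
- by move=> t _; exact: integral_ge0.
rewrite -(@fubini_tonelli _ _ _ _ _ m lebesgue_measure F2)//.
under eq_integral do rewrite slice_F2 EFinM.
rewrite ge0_integralZl//; last 2 first.
- apply/measurable_EFinP; apply: (measurableT_comp (measurable_powR _)).
  exact: measurableT_comp.
- by rewrite lee_fin divr_ge0 ?powR_ge0// ltW.
by rewrite muleA -EFinM /C !mulrA.
Qed.

(** [fine] sends [+oo] to 0, so the norm bound is blind to points where the maximal function is
    infinite; finiteness almost everywhere is a conclusion of its own. *)
Lemma maximal_strong :
  ((\int[m]_x (`|w x| `^ p)%:E < +oo)%E -> {ae m, forall x, (maximal w x < +oo)%E}) /\
  (\int[m]_x (fine (maximal w x) `^ p)%:E <=
    (p * C)%:E * \int[m]_x (`|w x| `^ p)%:E)%E.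
Proof.
split=> [Mlty|].
  have il : m.-integrable [set: X] layer.
    apply/integrableP; split => //.
    under eq_integral do rewrite gee0_abs//.
    apply: (le_lt_trans integral_layer); rewrite lte_mul_pinfty//.
    by rewrite lee_fin !(mulr_ge0, invr_ge0) ?powR_ge0// ltW.
  have := integrable_ae measurableT il; apply: filterS => x /(_ Logic.I) fx.
  rewrite ltNge leye_eq; apply/negP => /eqP Mx.
  (* If the maximal function is [+oo] at x, [layer_ge] at (p n)^(1 / p) gives [layer x >= n]; n is
     taken above the finite value of [layer x]. *)
  have [n hn] : exists n : R, 0 <= n /\ fine (layer x) < n.
    exists (`|fine (layer x)| + 1); split; first by rewrite addr_ge0.
    by rewrite ltr_pwDr// ler_norm.
  have := @layer_ge x ((p * n) `^ p^-1) (powR_ge0 _ _).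
  rewrite Mx leey => /(_ isT); rewrite -powRrM mulVf ?gt_eqF// powRr1; last first.
    by rewrite mulr_ge0 ?(ltW p0)//; case: hn.
  by rewrite -(fineK fx) lee_fin mulrAC mulfV ?gt_eqF// mul1r leNgt; case: hn => _ ->.
rewrite EFinM -muleA; apply: (@le_trans _ _ (\int[m]_x (p%:E * layer x))%E); last first.
  rewrite ge0_integralZl//; last by rewrite lee_fin ltW.
  by apply: lee_wpmul2l => //; rewrite lee_fin ltW.
apply: ge0_le_integral => //.
- by move=> x _; rewrite lee_fin powR_ge0.
- apply/measurable_EFinP; apply: (measurableT_comp (measurable_powR _)).
  by apply: measurableT_comp => //; exact: measurable_maximal.
- exact: measurable_funeM.
- move=> x _; have := maximal_ge0 w x; have := @layer_ge x (fine (maximal w x)).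
  case: (maximal w x) => [v| |]//= H v0.
    rewrite -lee_pdivrMl// -EFinM mulrC; exact: H.
  by rewrite powR0 ?gt_eqF// mule_ge0// lee_fin ltW.
Qed.

End strong.

End maximal_function.

(** * The approximation of the identity *)

Section cutoff_function.
Context (R : realType) (h : R -> R).
Hypothesis hh : cutoff h.
Implicit Types x y : R.

Lemma cutoff_ge0 x : 0 <= x -> 0 <= h x.
Proof. by case: hh => + _ _ _ _; exact. Qed.

Lemma cutoff_le1 x : 0 <= x -> h x <= 1.
Proof.
case: hh => _ hdec _ h1 _ x0; have h01 : h 0 = 1 by apply: h1; rewrite lexx invr_ge0 ler0n.
by rewrite -h01 hdec.
Qed.

Lemma cutoff_eq1 x : 0 <= x -> x <= 2^-1 -> h x = 1.
Proof. by case: hh => _ _ _ h1 _ x0 x2; rewrite h1 ?x0. Qed.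

Lemma cutoff_eq0 x : 2 <= x -> h x = 0.
Proof. by case: hh => _ _ _ _; exact. Qed.

(** On [1/2, 2] the continuous derivative is bounded. Outside, h is constant, so clamping the
    argument to [1/2, 2] leaves h unchanged, and clamping does not increase distances. This avoids
    differentiating at 0. *)
Lemma cutoff_lipschitz : exists2 L : R, 0 < L &
  forall x y, 0 <= x -> 0 <= y -> `|h x - h y| <= L * `|x - y|.
Proof.
have [_ _ dh h1 h0] := hh.
have dh0 x : 0 < x -> derivable h x 1 by exact: (dh 0).
have ch' x : 0 < x -> {for x, continuous (fun z => `|derive1 h z|)}.
  move=> x0; apply: (continuous_comp (f := derive1 h) (g := fun z : R => `|z|));
    last exact: norm_continuous.
  by apply/differentiable_continuous; apply/derivable1_diffP; exact: (dh 1).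
have h20 : 0 < (2^-1 : R) by rewrite invr_gt0.
have h22 : 2^-1 <= 2 :> R by lra.
have [z _ hz] : exists2 z, z \in `[2^-1, 2] &
    forall t, t \in `[2^-1, 2] -> `|derive1 h t| <= `|derive1 h z|.
  apply: EVT_max => //; apply: continuous_in_subspaceT => x.
  by rewrite inE/= in_itv/= => /andP[x2 _]; apply: ch'; exact: lt_le_trans x2.
set L := `|derive1 h z| + 1; have L0 : 0 < L by rewrite ltr_wpDl.
exists L => //.
pose cl x := Num.max 2^-1 (Num.min x 2).
have cl_itv x : 2^-1 <= cl x <= 2 by rewrite /cl le_max lexx ge_max h22 ge_min lexx orbT.
have hcl x : 0 <= x -> h (cl x) = h x.
  move=> x0; rewrite /cl; case: (leP x 2) => x2; last first.
    by rewrite max_r// h0// h0// ltW.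
  by case: (leP 2^-1 x) => x3 //; rewrite !h1 ?lexx ?h20 ?x0 ?ltW.
have clL' x y : x <= y -> `|cl x - cl y| <= `|x - y|.
  move=> xy; rewrite !(distrC _ (cl y)) (distrC x) [leRHS]ger0_norm ?subr_ge0//.
  rewrite ler_norml /cl; case: (leP x 2) => x2; case: (leP y 2) => y2;
    case: (leP 2^-1 x) => x3; case: (leP 2^-1 y) => y3;
    rewrite ?(max_r h22); lra.
have clL x y : `|cl x - cl y| <= `|x - y|.
  have [|/ltW] := leP x y; first exact: clL'.
  by rewrite distrC (distrC x); exact: clL'.
have mvt x y : 2^-1 <= x -> x <= y -> y <= 2 -> `|h x - h y| <= L * `|x - y|.
  move=> x2 xy y2; rewrite (distrC (h x)) (distrC x).
  have [||e ] := @MVT_segment R h (derive1 h) x y xy.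
  - move=> e; rewrite in_itv/= => /andP[xe _]; rewrite derive1E; apply: DeriveDef => //.
    by apply: dh0; rewrite (lt_trans _ xe)// (lt_le_trans h20).
  - apply: derivable_within_continuous => e; rewrite in_itv/= => /andP[xe _].
    by apply: dh0; rewrite (lt_le_trans _ xe)// (lt_le_trans h20).
  rewrite in_itv/= => /andP[xe ey] ->; rewrite normrM ler_wpM2r//.
  apply: (@le_trans _ _ `|derive1 h z|); last by rewrite lerDl.
  by apply: hz; rewrite in_itv/= (le_trans x2)//= (le_trans ey).
move=> x y x0 y0; rewrite -(hcl x)// -(hcl y)//.
have /andP[x1 x2] := cl_itv x; have /andP[y1 y2] := cl_itv y.
apply: (@le_trans _ _ (L * `|cl x - cl y|)); last by rewrite ler_wpM2l// ltW.
have [xy|/ltW yx] := leP (cl x) (cl y); first exact: mvt.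
by rewrite distrC (distrC (cl x)); exact: mvt.
Qed.

End cutoff_function.

Lemma lipschitz_metric_continuous (R : realType) (X : metricType R) (f : X -> R) (K : R) :
  (forall x y, `|f x - f y| <= K * mdist x y) -> continuous f.
Proof.
move=> fK x; apply/cvgrPdist_lt => e e0; apply/nbhs_ballP.
have K0 : 0 < `|K| + 1 by rewrite ltr_wpDl.
exists (e / (`|K| + 1)) => /=; first by rewrite divr_gt0.
move=> y; rewrite ballEmdist /= ltr_pdivlMr// => xy.
apply: (le_lt_trans (fK x y)); apply: le_lt_trans xy.
by rewrite mulrC ler_wpM2l ?mdist_ge0// (le_trans (ler_norm K))// lerDl.
Qed.

(** * Averages against the cut-off at scale t *)

Section averages.
Context (R : realType) (d : measure_display) (X : metricMeasurableType R d).
Context (m : {measure set X -> \bar R}) (N c : R) (h : R -> R) (L : R).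
Hypotheses (hBorel : borel_sigma_algebra X) (hN : 0 < N) (hc : 0 < c)
  (hAhlfors : ahlfors_regular m N c) (hh : cutoff h) (hL : 0 < L)
  (hLip : forall x y : R, 0 <= x -> 0 <= y -> `|h x - h y| <= L * `|x - y|).
Implicit Types (x y z : X) (t r B : R) (F : X -> R -> R).

(** One constant for both sides of the regularity: A t^N bounds the measure of a ball of radius 2 t
    from above, and A^-1 t^N that of a ball of radius t / 2 from below. *)
Let A := c * 2 `^ N.

Let A0 : 0 < A. Proof. by rewrite mulr_gt0// powR_gt0. Qed.

Let tN0 t : 0 < t -> 0 < t `^ N. Proof. exact: powR_gt0. Qed.

Lemma measure_ball2_le x t : 0 < t -> (m (ball x (2 * t)) <= (A * t `^ N)%:E)%E.
Proof.
move=> t0; have t20 : 0 < 2 * t by rewrite mulr_gt0.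
by apply: (le_trans (measure_ball_le hAhlfors _ t20)); rewrite powRM ?(ltW t0)// mulrA.
Qed.

Lemma dominated_by_indic (f : X -> R) (U : set X) B (M : R) :
  measurable_fun [set: X] f -> measurable U -> (m U <= M%:E)%E -> 0 <= B ->
  (forall y, `|f y| <= B * \1_U y) ->
  m.-integrable [set: X] (EFin \o f) /\ `|\int[m]_y f y| <= B * M.
Proof.
move=> mf mU UM B0 fU.
have mg : measurable_fun [set: X] (fun y => B * \1_U y).
  by apply: measurable_funM => //; exact: measurable_indic.
have intg : (\int[m]_y (B * \1_U y)%:E = B%:E * m U)%E.
  under eq_integral do rewrite EFinM.
  rewrite ge0_integralZl//; last by apply/measurable_EFinP; exact: measurable_indic.
  by rewrite integral_indic// setIT.
have ig : m.-integrable [set: X] (EFin \o (fun y => B * \1_U y)).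
  apply/integrableP; split; first exact/measurable_EFinP.
  under eq_integral do rewrite /= ger0_norm ?mulr_ge0//.
  by rewrite intg lte_mul_pinfty// (le_lt_trans UM)// ltry.
have if_ : m.-integrable [set: X] (EFin \o f).
  apply: le_integrable ig => //; first exact/measurable_EFinP.
  by move=> y _ /=; rewrite lee_fin (le_trans (fU y))// ler_norm.
split => //; apply: (le_trans (le_normr_Rintegral _ _)) => //.
apply: (@le_trans _ _ (\int[m]_y (B * \1_U y))).
  apply: le_Rintegral => //; first exact: integrable_norm.
rewrite /Rintegral intg -lee_fin fineK; last first.
  by rewrite fin_numM// ge0_fin_numE// (le_lt_trans UM)// ltry.
by rewrite EFinM; apply: lee_wpmul2l.
Qed.

Let bump x t y := h (mdist x y / t).

Let mdist_div_ge0 x y t : 0 < t -> 0 <= mdist x y / t.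
Proof. by move=> t0; rewrite divr_ge0 ?mdist_ge0// ltW. Qed.

Let bump_norm x t y : 0 < t -> `|bump x t y| <= \1_(ball x (2 * t)) y.
Proof.
move=> t0; rewrite ger0_norm ?(cutoff_ge0 hh) ?mdist_div_ge0// indicE.
case: (boolP (y \in _)); first by move=> _; rewrite (cutoff_le1 hh) ?mdist_div_ge0.
rewrite notin_setE in_ball => /negP; rewrite -leNgt => ty.
by rewrite /bump (cutoff_eq0 hh)// ler_pdivlMr.
Qed.

(** Both bumps vanish off the two balls, so the Lipschitz bound keeps a support of measure
    O(t^N). *)
Let bump_lip x x' t y : 0 < t ->
  `|bump x t y - bump x' t y| <=
    L * (mdist x x' / t) * \1_(ball x (2 * t) `|` ball x' (2 * t)) y.
Proof.
move=> t0; rewrite indicE; case: (boolP (y \in _)) => [_|]; last first.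
  rewrite notin_setE => /not_orP[]; rewrite !in_ball => /negP + /negP.
  rewrite -!leNgt => xy x'y.
  by rewrite /bump !(cutoff_eq0 hh) ?ler_pdivlMr// subrr normr0 mulr0.
rewrite mulr1; apply: (le_trans (hLip _ _)); rewrite ?mdist_div_ge0//.
rewrite ler_wpM2l ?(ltW hL)// -mulrBl normrM (@ger0_norm _ t^-1) ?invr_ge0 ?(ltW t0)//.
rewrite ler_wpM2r ?invr_ge0 ?(ltW t0)//.
have := metric_triangle x x' y; have := metric_triangle x' x y.
by rewrite (metric_sym x' x) ler_norml; lra.
Qed.

Let bump_measurable x t : 0 < t -> measurable_fun [set: X] (bump x t).
Proof.
move=> t0; apply: continuous_borel => //.
apply: (@lipschitz_metric_continuous _ _ _ (L / t)) => y z.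
apply: (le_trans (hLip _ _)); rewrite ?mdist_div_ge0//.
rewrite -mulrA ler_wpM2l ?(ltW hL)// -mulrBl normrM (@ger0_norm _ t^-1) ?invr_ge0 ?(ltW t0)//.
rewrite mulrC ler_wpM2l ?invr_ge0 ?(ltW t0)//.
have := metric_triangle x z y; have := metric_triangle x y z.
by rewrite (metric_sym z y) ler_norml; lra.
Qed.

Let bump_continuous x y t : 0 < t -> {for t, continuous (fun s => bump x s y)}.
Proof.
move=> t0; apply/cvgrPdist_lt => e e0.
have ct : {for t, continuous (fun s : R => L * (mdist x y / s))}.
  apply: continuousM; first exact: cvg_cst.
  by apply: continuousM; [exact: cvg_cst|apply: cvgV => //; rewrite gt_eqF].
have /cvgrPdist_lt/(_ e e0) H := ct.
near=> s; have s0 : 0 < s by near: s; exact: lt_nbhsr.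
apply: (le_lt_trans (hLip _ _)); rewrite ?mdist_div_ge0//.
rewrite -(@ger0_norm _ L) ?(ltW hL)// -normrM mulrBr.
by near: s.
Unshelve. all: by end_near. Qed.

(** A class stable under the steps that build s: it contains the constant 1, then [phi], then [psi],
    then [psi] times a bump. *)
Definition admissible F B := [/\ forall t, 0 < t -> measurable_fun [set: X] (F^~ t),
  forall x t, 0 < t -> {for t, continuous (F x)} &
  forall x t, 0 < t -> `|F x t| <= B].

Lemma admissible_bound_ge0 F B (x : X) : admissible F B -> 0 <= B.
Proof. by move=> [_ _ /(_ x 1 ltr01)]; exact: le_trans. Qed.

(** The operator T_t without its factor t^-N. [F] may depend on the scale because T_t is iterated at
    the same t. *)
Definition average F x t := \int[m]_y (h (mdist x y / t) * F y t).

Section average.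
Variables (F : X -> R -> R) (B : R).
Hypothesis aF : admissible F B.

Let measurable_integrand x t : 0 < t ->
  measurable_fun [set: X] (fun y => h (mdist x y / t) * F y t).
Proof.
by move=> t0; case: aF => mF _ _; apply: measurable_funM; [exact: bump_measurable|exact: mF].
Qed.

Let dominated_integrand x t : 0 < t ->
  m.-integrable [set: X] (EFin \o (fun y => h (mdist x y / t) * F y t)) /\
  `|average F x t| <= B * (A * t `^ N).
Proof.
move=> t0; apply: (@dominated_by_indic _ (ball x (2 * t))) => //.
- exact: measurable_integrand.
- exact: measurable_metric_ball.
- exact: measure_ball2_le.
- exact: admissible_bound_ge0 x aF.
- move=> y; rewrite normrM mulrC; apply: ler_pM => //; last exact: bump_norm.
  by case: aF => _ _; exact.
Qed.

Lemma average_norm_le x t : 0 < t -> `|average F x t| <= B * (A * t `^ N).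
Proof. by move=> /(dominated_integrand x)[]. Qed.

Lemma average_lip x x' t : 0 < t ->
  `|average F x t - average F x' t| <= 2 * L * B * A * (mdist x x' / t) * t `^ N.
Proof.
move=> t0; have B0 := admissible_bound_ge0 x aF.
rewrite /average -RintegralB//; [|exact: (dominated_integrand x t0).1
  |exact: (dominated_integrand x' t0).1].
under eq_Rintegral do rewrite -mulrBl.
have := @dominated_by_indic (fun y => (h (mdist x y / t) - h (mdist x' y / t)) * F y t)
  (ball x (2 * t) `|` ball x' (2 * t)) (L * (mdist x x' / t) * B)
  (A * t `^ N + A * t `^ N).
case=> [||||y|_].
- apply: measurable_funM; last by case: aF => + _ _; exact.
  by apply: measurable_funB; exact: bump_measurable.
- by apply: measurableU; exact: measurable_metric_ball.
- apply: (le_trans (measureU2 _ _ _)); [exact: measurable_metric_ball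
    |exact: measurable_metric_ball|].
  by rewrite EFinD; apply: leeD; exact: measure_ball2_le.
- by rewrite mulr_ge0// mulr_ge0 ?(ltW hL)// mdist_div_ge0.
- rewrite normrM mulrAC; apply: ler_pM => //; first exact: bump_lip.
  by case: aF => _ _; exact.
move=> /le_trans; apply; rewrite le_eqVlt; apply/orP; left; apply/eqP; ring.
Qed.

Lemma average_continuous x t : 0 < t -> {for t, continuous (average F x)}.
Proof.
move=> t0; have B0 := admissible_bound_ge0 x aF.
(* Continuity is local: for s in ]t / 2, 2 t[ all supports lie in the ball of radius 4 t, whose
   indicator dominates. *)
have tI : t \in `]t / 2, 2 * t[%classic.
  by rewrite inE/= in_itv/=; apply/andP; split; lra.
have I0 s : `]t / 2, 2 * t[%classic s -> 0 < s.
  by rewrite /= in_itv/= => /andP[ts _]; rewrite (lt_trans _ ts)// divr_gt0.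
apply: (@continuity_under_integral R d X m (fun s y => h (mdist x y / s) * F y s)
  setT measurableT (t / 2) (2 * t) _ _ (fun y => B * \1_(ball x (2 * (2 * t))) y)) => //.
- by move=> s /I0 s0; exact: (dominated_integrand x s0).1.
- apply: aeW => y _ s; rewrite inE => /I0 s0.
  by apply: continuousM; [exact: bump_continuous|case: aF => _ + _; exact].
- have t20 : 0 < 2 * t by rewrite mulr_gt0.
  apply: (dominated_by_indic (U := ball x (2 * (2 * t))) _ _ (measure_ball2_le _ t20) B0 _).1.
  + apply: measurable_funM => //; apply: measurable_indic.
    exact: measurable_metric_ball.
  + exact: measurable_metric_ball.
  + by move=> y; rewrite ger0_norm// mulr_ge0.
- move=> s Is; apply: aeW => y _; have s0 := I0 s Is.
  rewrite normrM mulrC; apply: ler_pM => //; first by case: aF => _ _; exact.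
  apply: (le_trans (bump_norm _ _ s0)); rewrite !indicE ler_nat.
  case: (boolP (y \in (ball x (2 * s) : set X))) => //; rewrite inE in_ball => ys.
  rewrite mem_set// in_ball (lt_le_trans ys)// ler_wpM2l//.
  by move: Is; rewrite /= in_itv/= => /andP[_ /ltW].
Qed.

Lemma average_measurable t : 0 < t -> measurable_fun [set: X] (average F ^~ t).
Proof.
move=> t0; apply: continuous_borel => //.
apply: (@lipschitz_metric_continuous _ _ _ (2 * L * B * A / t * t `^ N)) => x y.
apply: (le_trans (average_lip _ _ t0)).
by rewrite le_eqVlt; apply/orP; left; apply/eqP; ring.
Qed.

(** The cut-off equals 1 on the ball of radius t / 2, whose measure is at least A^-1 t^N. *)
Lemma average_ge b x t : 0 <= b -> (forall y, b <= F y t) -> 0 < t ->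
  b * (A^-1 * t `^ N) <= average F x t.
Proof.
move=> b0 bF t0; have t20 : 0 < t / 2 by rewrite divr_gt0.
have mB : measurable (ball x (t / 2)) by exact: measurable_metric_ball.
have mlt := le_lt_trans (measure_ball_le hAhlfors x t20) (ltry _).
have mge := measure_ball_ge hAhlfors x t20.
have [ifx _] := dominated_integrand x t0.
rewrite /average /Rintegral -lee_fin fineK; last exact: integrable_fin_num.
apply: (@le_trans _ _ (\int[m]_y (b * \1_(ball x (t / 2)) y)%:E)%E).
  under eq_integral do rewrite EFinM.
  rewrite ge0_integralZl//; last by apply/measurable_EFinP; exact: measurable_indic.
  rewrite integral_indic// setIT EFinM; apply: lee_wpmul2l; first by rewrite lee_fin.
  apply: le_trans mge; rewrite lee_fin powRM ?invr_ge0 ?(ltW t0)//.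
  rewrite /A invfM -powRN -mulrA ler_wpM2l ?invr_ge0 ?(ltW hc)//.
  by rewrite mulrC -(powR_inv1 (ler0n R 2)) -powRrM mulN1r.
apply: ge0_le_integral => //.
- by move=> y _; rewrite lee_fin mulr_ge0.
- by apply/measurable_EFinP; apply: measurable_funM => //; exact: measurable_indic.
- by apply/measurable_EFinP; exact: measurable_integrand.
- move=> y _; rewrite lee_fin indicE; case: (boolP (y \in _)) => [|_].
    rewrite inE in_ball => /ltW yt; rewrite mulr1 (cutoff_eq1 hh) ?mul1r//.
      exact: mdist_div_ge0.
    by rewrite ler_pdivrMr// mulrC.
  rewrite mulr0; apply: mulr_ge0; last exact: le_trans b0 (bF y).
  by apply: (cutoff_ge0 hh); exact: mdist_div_ge0.
Qed.

(** Applied to the constant 1 it yields [phi], applied to [phi] it yields [psi]; the lower bound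
    keeps the inverse bounded and continuous. *)
Lemma admissible_inv_average b : 0 < b ->
  (forall x t, 0 < t -> b * t `^ N <= average F x t) ->
  admissible (fun x t => (t `^ (- N) * average F x t)^-1) b^-1.
Proof.
move=> b0 bF.
have ge_b x t : 0 < t -> b <= t `^ (- N) * average F x t.
  by move=> t0; rewrite powRN ler_pdivlMl ?tN0// mulrC bF.
have gt0 x t : 0 < t -> 0 < t `^ (- N) * average F x t.
  by move=> t0; rewrite (lt_le_trans b0)// ge_b.
split.
- move=> t t0 /=; apply: (@measurableT_comp _ _ _ _ _ _ (fun r : R => r^-1));
    first exact: measurable_inv.
  by apply: measurable_funM => //; exact: average_measurable.
- move=> x t t0; have ct : {for t, continuous (fun s : R => s `^ (- N))}.
    apply/differentiable_continuous; apply/derivable1_diffP; apply: derivable_powR.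
    by rewrite in_itv/= t0.
  have := continuousM ct (average_continuous (x := x) t0).
  by move=> /(cvgV (lt0r_neq0 (gt0 x t t0))).
- move=> x t t0; rewrite ger0_norm; last by rewrite invr_ge0 ltW ?gt0.
  by rewrite lef_pV2 ?posrE ?gt0// ge_b.
Qed.

End average.

Lemma admissible_cst1 : admissible (fun _ _ => 1) 1.
Proof.
by split => [t _|x t _|x t _]; [exact: measurable_cst|exact: cst_continuous|rewrite normr1].
Qed.

Lemma admissible_cutoffM F B x : admissible F B ->
  admissible (fun y t => h (mdist x y / t) * F y t) B.
Proof.
move=> [mF cF bF]; split=> [t t0|y t t0|y t t0].
- by apply: measurable_funM; [exact: bump_measurable|exact: mF].
- by apply: continuousM; [exact: bump_continuous|exact: cF].
- rewrite normrM -[leRHS]mul1r; apply: ler_pM => //; last exact: bF.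
  by rewrite (le_trans (bump_norm _ _ t0))// indicE lern1 leq_b1.
Qed.

End averages.

(** * Size and regularity of the kernel s(x, z, t) *)

Section kernel.
Context (R : realType) (d : measure_display) (X : metricMeasurableType R d).
Context (m : {measure set X -> \bar R}) (N c : R) (h : R -> R) (L : R).
Hypotheses (hBorel : borel_sigma_algebra X) (hN : 0 < N) (hc : 0 < c)
  (hAhlfors : ahlfors_regular m N c) (hh : cutoff h) (hL : 0 < L)
  (hLip : forall x y : R, 0 <= x -> 0 <= y -> `|h x - h y| <= L * `|x - y|).
Implicit Types (x y z : X) (t r B : R) (F : X -> R -> R).

Let A := c * 2 `^ N.

Let A0 : 0 < A. Proof. by rewrite mulr_gt0// powR_gt0. Qed.

Let tN0 t : 0 < t -> 0 < t `^ N. Proof. exact: powR_gt0. Qed.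

Let avg1_ge x t : 0 < t -> A^-1 * t `^ N <= average m h (fun _ _ => 1) x t.
Proof.
move=> t0.
have := average_ge hBorel hc hAhlfors hh hL hLip (admissible_cst1 X) x
  (b := 1) ler01 (fun=> lexx _) t0.
by rewrite mul1r.
Qed.

Let phi_admissible : admissible (phi m N h) A.
Proof.
rewrite -[A]invrK; apply: (admissible_inv_average hBorel hAhlfors hh hL hLip (admissible_cst1 X)).
  by rewrite invr_gt0.
exact: avg1_ge.
Qed.

Let phi_gt0 x t : 0 < t -> 0 < phi m N h x t.
Proof.
move=> t0; rewrite invr_gt0 mulr_gt0 ?powR_gt0//.
by apply: (lt_le_trans _ (avg1_ge x t0)); rewrite mulr_gt0 ?invr_gt0 ?tN0.
Qed.

Let phi_le x t : 0 < t -> phi m N h x t <= A.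
Proof.
by case: phi_admissible => _ _ H t0; apply: le_trans (H x t t0); exact: ler_norm.
Qed.

Let phi_ge x t : 0 < t -> A^-1 <= phi m N h x t.
Proof.
move=> t0; have := phi_gt0 x t0.
have -> : phi m N h x t = (t `^ (- N) * average m h (fun _ _ => 1) x t)^-1 by [].
rewrite invr_gt0 => p0; rewrite lef_pV2 ?posrE// powRN ler_pdivrMl ?tN0//.
rewrite mulrC -[leRHS]mul1r.
apply: le_trans (average_norm_le hBorel hAhlfors hh hL hLip (admissible_cst1 X) x t0).
exact: ler_norm.
Qed.

Let phi_lip x y t : 0 < t ->
  `|phi m N h x t - phi m N h y t| <= 2 * L * A ^+ 3 * (mdist x y / t).
Proof.
move=> t0; have px := phi_gt0 x t0; have py := phi_gt0 y t0.
have E z : phi m N h z t = (t `^ (- N) * average m h (fun _ _ => 1) z t)^-1 by [].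
(* As 1 / phi is the normalised average, u - v = u v (1 / v - 1 / u) transfers the Lipschitz bound
   of averages to [phi]. *)
have -> : phi m N h x t - phi m N h y t = phi m N h x t * phi m N h y t *
    (t `^ (- N) * (average m h (fun _ _ => 1) y t - average m h (fun _ _ => 1) x t)).
  rewrite mulrBr.
  have Ei z : t `^ (- N) * average m h (fun _ _ => 1) z t = (phi m N h z t)^-1.
    by rewrite E invrK.
  by rewrite !Ei; field; rewrite !gt_eqF.
rewrite !normrM (gtr0_norm px) (gtr0_norm py) (@ger0_norm _ (t `^ _)) ?powR_ge0//.
have H := average_lip hBorel hAhlfors hh hL hLip (admissible_cst1 X) y x t0.
have -> : 2 * L * A ^+ 3 * (mdist x y / t) = A * A * (t `^ (- N) *
    (2 * L * 1 * A * (mdist y x / t) * t `^ N)).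
  by rewrite powRN metric_sym; field; rewrite !gt_eqF// tN0.
apply: ler_pM => //; first by rewrite mulr_ge0// ltW.
- by rewrite mulr_ge0 ?powR_ge0.
- by apply: ler_pM => //; rewrite ?phi_le// ltW.
- by rewrite ler_wpM2l// powR_ge0.
Qed.

Let psi_admissible : admissible (psi m N h) (A ^+ 2).
Proof.
rewrite -[A ^+ 2]invrK; apply: (admissible_inv_average hBorel hAhlfors hh hL hLip phi_admissible).
  by rewrite invr_gt0 exprn_gt0.
move=> x t t0; rewrite expr2 invfM -mulrA.
apply: (average_ge hBorel hc hAhlfors hh hL hLip phi_admissible) => //.
  by rewrite invr_ge0 ltW.
by move=> y; exact: phi_ge.
Qed.

Let window y z t := h (mdist y z / t) * psi m N h z t.

Let window_admissible y : admissible (window y) (A ^+ 2).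
Proof. exact: (admissible_cutoffM hBorel hh hL hLip y psi_admissible). Qed.

(** Reading the inner integral as the average of [window y] makes the general bounds on averages
    available for s. *)
Lemma approx_kernelE x y t : approx_kernel m N h x y t =
  phi m N h x t * phi m N h y t / t `^ (2 * N) * average m h (window y) x t.
Proof. by congr (_ * _); apply: eq_Rintegral => z _; rewrite mulrA. Qed.

Lemma approx_kernel_sym x y t : approx_kernel m N h x y t = approx_kernel m N h y x t.
Proof.
rewrite /approx_kernel (mulrC (phi _ _ _ x t)); congr (_ * _).
by apply: eq_Rintegral => z _; rewrite (mulrC (h _)).
Qed.

Let window_far x y t : 0 < t -> 4 * t <= mdist x y -> average m h (window y) x t = 0.
Proof.
move=> t0 xy; rewrite /average /Rintegral integral0_eq// => z _.
have [xz|xz] := leP (2 * t) (mdist x z).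
  by rewrite (cutoff_eq0 hh) ?mul0r// ler_pdivlMr.
rewrite /window (cutoff_eq0 hh (x := mdist y z / t)) ?mul0r ?mulr0// ler_pdivlMr//.
by have := metric_triangle x z y; rewrite (metric_sym z y); lra.
Qed.

Let near_ind x y t : R := (mdist x y < 4 * t)%R%:R.

Let window_norm x y t : 0 < t ->
  `|average m h (window y) x t| <= A ^+ 3 * t `^ N * near_ind x y t.
Proof.
move=> t0; rewrite /near_ind; case: ltP => [_|xy]; last first.
  by rewrite window_far// normr0 mulr0.
rewrite mulr1 exprSr -mulrA.
exact: (average_norm_le hBorel hAhlfors hh hL hLip (window_admissible y)).
Qed.

Let t2N t : 0 < t -> t `^ (2 * N) = t `^ N * t `^ N.
Proof.
by move=> t0; rewrite -powRD; [congr (_ `^ _); ring|rewrite (gt_eqF t0) implybT].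
Qed.

(** Two factors A come from the two values of [phi], two from [psi] and one from the measure of the
    ball. *)
Let approx_kernel_norm5 x y t : 0 < t ->
  `|approx_kernel m N h x y t| <= A ^+ 5 * (t `^ (- N) * near_ind x y t).
Proof.
move=> t0; rewrite approx_kernelE !normrM (gtr0_norm (phi_gt0 x t0)) (gtr0_norm (phi_gt0 y t0)).
rewrite normfV (@ger0_norm _ (t `^ _)) ?powR_ge0// t2N// powRN.
have -> : A ^+ 5 * ((t `^ N)^-1 * near_ind x y t) =
    A * A / (t `^ N * t `^ N) * (A ^+ 3 * t `^ N * near_ind x y t).
  by field; rewrite gt_eqF// tN0.
have tt : 0 <= (t `^ N * t `^ N)^-1 by rewrite invr_ge0 mulr_ge0// powR_ge0.
apply: ler_pM => //; last exact: window_norm.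
- by rewrite !mulr_ge0// ltW ?phi_gt0.
- by rewrite ler_wpM2r//; apply: ler_pM; rewrite ?phi_le// ltW ?phi_gt0.
Qed.

Let approx_kernel_diff x y z t : 0 < t ->
  `|approx_kernel m N h x z t - approx_kernel m N h y z t| <=
  2 * L * (A ^+ 7 + A ^+ 5) * (mdist x y / t * t `^ (- N)).
Proof.
move=> t0; rewrite !approx_kernelE t2N//.
set u := phi m N h x t; set v := phi m N h y t; set w := phi m N h z t.
set P := average m h (window z) x t; set Q := average m h (window z) y t.
(* Product rule for differences; the first term leads to A^7, the second to A^5. *)
have -> : u * w / (t `^ N * t `^ N) * P - v * w / (t `^ N * t `^ N) * Q =
  w / (t `^ N * t `^ N) * ((u - v) * P + v * (P - Q)) by ring.
have tt : 0 < (t `^ N * t `^ N)^-1 by rewrite invr_gt0 mulr_gt0// tN0.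
have w0 : 0 < w := phi_gt0 z t0.
have v0 : 0 < v := phi_gt0 y t0.
have d0 : 0 <= mdist x y / t by rewrite divr_ge0 ?mdist_ge0// ltW.
rewrite normrM normrM (gtr0_norm w0) (gtr0_norm tt).
have -> : 2 * L * (A ^+ 7 + A ^+ 5) * (mdist x y / t * t `^ (- N)) =
  A / (t `^ N * t `^ N) * (2 * L * A ^+ 3 * (mdist x y / t) * (A ^+ 3 * t `^ N) +
    A * (2 * L * A ^+ 2 * A * (mdist x y / t) * t `^ N)).
  by rewrite powRN; field; rewrite !gt_eqF// tN0.
apply: ler_pM => //; first by rewrite ltW// mulr_gt0.
  by rewrite ler_wpM2r ?(ltW tt)// phi_le.
apply: (le_trans (ler_normD _ _)); rewrite !normrM (gtr0_norm v0); apply: lerD.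
  apply: ler_pM => //; first exact: phi_lip.
  rewrite /P exprSr -mulrA.
  exact: (average_norm_le hBorel hAhlfors hh hL hLip (window_admissible z)).
apply: ler_pM => //; [exact: ltW|exact: phi_le|].
exact: (average_lip hBorel hAhlfors hh hL hLip (window_admissible z)).
Qed.

Lemma approx_kernel_ge0 x z t : 0 < t -> 0 <= approx_kernel m N h x z t.
Proof.
move=> t0; have mdist_div_ge0 y y' : 0 <= mdist y y' / t.
  by rewrite divr_ge0 ?mdist_ge0// ltW.
have avg_ge0 F y : (forall y', 0 <= F y' t) -> 0 <= average m h F y t.
  move=> F0; apply: Rintegral_ge0 => y' _.
  by apply: mulr_ge0 => //; exact: (cutoff_ge0 hh (mdist_div_ge0 _ _)).
have psi_ge0 y : 0 <= psi m N h y t.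
  rewrite /psi invr_ge0 mulr_ge0 ?powR_ge0//.
  by apply: (avg_ge0 (phi m N h)) => y'; exact: ltW (phi_gt0 y' t0).
rewrite approx_kernelE mulr_ge0//.
  by rewrite mulr_ge0 ?invr_ge0 ?powR_ge0// mulr_ge0// ltW// phi_gt0.
by apply: avg_ge0 => y'; apply: mulr_ge0 => //; exact: (cutoff_ge0 hh (mdist_div_ge0 _ _)).
Qed.

Lemma approx_kernel_measurable x t : 0 < t ->
  measurable_fun [set: X] (fun z => approx_kernel m N h x z t).
Proof.
move=> t0; have [mphi _ _] := phi_admissible.
(* Symmetry puts z in the slot in which averages are known to be measurable. *)
have -> : (fun z => approx_kernel m N h x z t) = (fun z =>
    phi m N h z t * phi m N h x t / t `^ (2 * N) * average m h (window x) z t).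
  by apply/funext => z; rewrite approx_kernel_sym approx_kernelE.
apply: measurable_funM; last first.
  exact: (average_measurable hBorel hAhlfors hh hL hLip (window_admissible x)).
by apply: measurable_funM => //; apply: measurable_funM => //; exact: mphi.
Qed.

Lemma approx_kernel_continuous x z t : 0 < t ->
  {for t, continuous (approx_kernel m N h x z)}.
Proof.
move=> t0; have [_ cphi _] := phi_admissible.
have -> : approx_kernel m N h x z = (fun t =>
    phi m N h x t * phi m N h z t * (t `^ (2 * N))^-1 * average m h (window z) x t).
  by apply/funext => s; rewrite approx_kernelE.
have ct : {for t, continuous (fun s : R => (s `^ (2 * N))^-1)}.
  have ct : {for t, continuous (fun s : R => s `^ (2 * N))}.
    apply/differentiable_continuous; apply/derivable1_diffP; apply: derivable_powR.
    by rewrite in_itv/= t0.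
  by move: ct => /(cvgV (lt0r_neq0 (powR_gt0 (2 * N) t0))).
have ca := average_continuous hBorel hAhlfors hh hL hLip (window_admissible z) (x := x) t0.
exact: continuousM (continuousM (continuousM (cphi x t t0) (cphi z t t0)) ct) ca.
Qed.

(** If d(x, y) > t, the two size bounds suffice. Otherwise, if z is within 4 t of x or y, the sum of
    indicators is at least 1 and the Lipschitz bound applies; if z is far from both, both kernels
    vanish. *)
Lemma approx_kernel_bounds : exists2 K : R, 0 < K &
  (forall x z t, 0 < t ->
    `|approx_kernel m N h x z t| <= K * (t `^ (- N) * (mdist x z < 4 * t)%R%:R)) /\
  (forall x y z t, 0 < t ->
    `|approx_kernel m N h x z t - approx_kernel m N h y z t| <=
    K * Num.min 1 (mdist x y / t) *
      (t `^ (- N) * (mdist x z < 4 * t)%R%:R + t `^ (- N) * (mdist y z < 4 * t)%R%:R)).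
Proof.
have A5 : 0 < A ^+ 5 by rewrite exprn_gt0.
have L7 : 0 < 2 * L * (A ^+ 7 + A ^+ 5) by rewrite !mulr_gt0// addr_gt0// exprn_gt0.
pose K := A ^+ 5 + 2 * L * (A ^+ 7 + A ^+ 5).
have K0 : 0 < K by rewrite addr_gt0.
have K1 x z t : 0 < t ->
    `|approx_kernel m N h x z t| <= K * (t `^ (- N) * (mdist x z < 4 * t)%R%:R).
  move=> t0; apply: (le_trans (approx_kernel_norm5 x z t0)).
  by rewrite ler_wpM2r ?mulr_ge0 ?powR_ge0// /K lerDl ltW.
exists K => //; split => // x y z t t0.
have tm0 : 0 <= t `^ (- N) by rewrite powR_ge0.
have [dt|dt] := ltP 1 (mdist x y / t).
  rewrite mulr1 mulrDr; apply: (le_trans (ler_normB _ _)).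
  by apply: lerD; exact: K1.
have d0 : 0 <= mdist x y / t by rewrite divr_ge0 ?mdist_ge0// ltW.
rewrite -mulrDr; have [near|] := boolP ((mdist x z < 4 * t) || (mdist y z < 4 * t)).
  apply: (le_trans (approx_kernel_diff x y z t0)).
  rewrite [leRHS]mulrA -[leRHS]mulrA -[leRHS]mulrA; apply: ler_pM.
  - exact: ltW.
  - exact: mulr_ge0.
  - by rewrite /K lerDr ltW.
  - rewrite ler_wpM2l// ler_peMr// -natrD ler1n.
    by case/orP: near => ->; rewrite ?addn_gt0 ?orbT.
rewrite negb_or => /andP[xz yz].
have := K1 x z t t0; rewrite (negbTE xz) !mulr0 normr_le0 => /eqP ->.
have := K1 y z t t0; rewrite (negbTE yz) !mulr0 normr_le0 => /eqP ->.
by rewrite subrr normr0 addr0 !mulr0.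
Qed.

End kernel.

(** * The Bessel potential *)

Section caratheodory.
Context (d : measure_display) (T : measurableType d) (R : realType).
Variable F : T -> R -> R.
Hypotheses (mF : forall t, 0 < t -> measurable_fun [set: T] (F^~ t))
  (cF : forall x t, 0 < t -> {for t, continuous (F x)}).

(* Freezing the second argument on a grid of mesh [n.+1%:R^-1] gives functions
   that are measurable strip by strip and converge by continuity. *)
Lemma measurable_caratheodory : measurable_fun [set: T * measurableTypeR R]
  (fun q => if 0 < (q.2 : R) then F q.1 q.2 else 0).
Proof.
(* The right end of the grid cell is taken: it is positive even in the cell next to 0, and [F] is
   controlled at positive times only. *)
pose g (n : nat) (t : R) := (Num.truncn (t * n.+1%:R)).+1%:R / n.+1%:R : R.
pose G (n : nat) (q : T * measurableTypeR R) := if 0 < q.2 then F q.1 (g n q.2) else 0.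
apply: (@measurable_fun_cvg _ _ _ _ G) => [n|[x t] _].
  pose E (k : nat) : set (T * measurableTypeR R) :=
    if k is k'.+1 then snd @^-1` ([set` `]0%R, +oo[] `&`
      [set` `[k'%:R / n.+1%:R, k'.+1%:R / n.+1%:R[])
    else snd @^-1` [set` `]-oo, 0%R]].
  have mE k : measurable (E k).
    case: k => [|k]; rewrite -[X in measurable X]setTI; apply: measurable_snd => //.
    exact: measurableI.
  have -> : [set: T * measurableTypeR R] = \bigcup_k E k.
    apply/seteqP; split => // -[x t] _.
    have [t0|t0] := leP t 0; first by exists 0%N => //=; rewrite in_itv.
    exists (Num.truncn (t * n.+1%:R)).+1 => //=; split; first by rewrite in_itv/= t0.
    have /andP[h1 h2] : (Num.truncn (t * n.+1%:R))%:R <= t * n.+1%:R <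
        (Num.truncn (t * n.+1%:R)).+1%:R.
      by apply: truncn_itv; rewrite mulr_ge0// ltW.
    by rewrite in_itv/= ler_pdivrMr// h1 ltr_pdivlMr.
  apply/measurable_fun_bigcup => // -[|k].
    apply: (@eq_measurable_fun _ _ _ _ _ (cst (0 : R))); last exact: measurable_cst.
    by move=> [x t]; rewrite inE /G/= in_itv/= => t0; rewrite ltNge t0.
  apply: (@eq_measurable_fun _ _ _ _ _
    (fun q : T * measurableTypeR R => F q.1 (k.+1%:R / n.+1%:R))).
    move=> [x t]; rewrite inE /G/= !in_itv/= andbT => -[t0 /andP[h1 h2]].
    rewrite t0 /g; congr (F _ (_.+1%:R / _)); apply/esym/truncn_def.
    by rewrite -ler_pdivrMr// h1 -ltr_pdivlMr.
  apply: measurable_funTS.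
  apply: (@measurableT_comp _ _ _ _ _ _ (F^~ (k.+1%:R / n.+1%:R)) _ fst) => //.
  by apply: mF; rewrite divr_gt0.
rewrite /G/=; case: ltP => t0; last exact: cvg_cst.
have Fxt : {for (t : R), continuous (F x)} by exact: cF.
suff gt : g n t @[n --> \oo] --> (t : R) by exact: continuous_cvg.
apply/cvgrPdist_le => e e0.
exists (Num.truncn e^-1) => // n /= en.
have nt : n.+1%:R^-1 <= e.
  rewrite -[leRHS]invrK lef_pV2 ?posrE ?invr_gt0//.
  by apply: (le_trans (ltW (truncnS_gt _))); rewrite ler_nat ltnS.
apply: le_trans nt; rewrite distrC /g.
have /andP[h1 h2] : (Num.truncn (t * n.+1%:R))%:R <= t * n.+1%:R <
        (Num.truncn (t * n.+1%:R)).+1%:R.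
  by apply: truncn_itv; rewrite mulr_ge0// ltW.
rewrite ger0_norm; last by rewrite subr_ge0 ler_pdivlMr// ltW.
rewrite lerBlDr ler_pdivrMr// mulrDl mulVf ?pnatr_eq0//.
by rewrite -natr1 addrC lerD2l.
Qed.

End caratheodory.

(** * Integrals of the weight in the Bessel kernel *)

Section weight.
Context (R : realType).
Implicit Types alpha beta t u r : R.

Definition bessel_weight alpha t : R := t `^ alpha / (1 + t `^ alpha) ^+ 2.

Lemma bessel_weight_ge0 alpha t : 0 <= bessel_weight alpha t.
Proof. by rewrite divr_ge0 ?powR_ge0// sqr_ge0. Qed.

Let weight_le u : 0 <= u -> u / (1 + u) ^+ 2 <= 1 /\ u / (1 + u) ^+ 2 <= u /\
  (0 < u -> u / (1 + u) ^+ 2 <= u^-1).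
Proof.
move=> u0; have p0 : 0 < (1 + u) ^+ 2 by rewrite exprn_gt0// ltr_pwDl.
split; [|split => [|u1]].
- by rewrite ler_pdivrMr// mul1r; nra.
- by rewrite ler_pdivrMr//; nra.
- by rewrite ler_pdivrMr// ler_pdivlMl//; nra.
Qed.

(** For t <= 1 the weight is at most t^alpha <= t^beta; for t >= 1 it is at most 1 <= t^beta. *)
Lemma bessel_weight_le_powR alpha beta t : 0 < beta -> beta <= alpha -> 0 < t ->
  bessel_weight alpha t <= t `^ beta.
Proof.
move=> b0 ba t0; have [h1 [h2 _]] := weight_le (powR_ge0 t alpha).
have [t1|/ltW t1] := leP t 1.
  by apply: (le_trans h2); apply: ger_powR => //; rewrite t0.
apply: (le_trans h1); rewrite -(powRr0 t); apply: ler_powR => //; exact: ltW.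
Qed.

(** With u = t^alpha this is u / (1 + u)^2 <= min(u, 1 / u), shaped for [integral_powR_min_le] with
    r = 1 and exponents alpha and 2 alpha. *)
Lemma bessel_weight_le_min alpha t : 0 < alpha -> 0 < t ->
  bessel_weight alpha t <= t `^ alpha * Num.min 1 ((1 / t) `^ (2 * alpha)).
Proof.
move=> a0 t0; have [_ [h2 h3]] := weight_le (powR_ge0 t alpha).
case: (leP 1 ((1 / t) `^ (2 * alpha))) => _; first by rewrite mulr1.
apply: (le_trans (h3 (powR_gt0 _ t0))); rewrite div1r -(powR_inv1 (ltW t0)).
rewrite -powRrM -powRD; last by rewrite (gt_eqF t0) implybT.
by rewrite -powRN le_eqVlt; apply/orP; left; apply/eqP; congr (_ `^ _); ring.
Qed.

Lemma measurable_bessel_weight alpha : measurable_fun [set: R] (bessel_weight alpha).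
Proof.
apply: measurable_funM; first exact: measurable_powR.
apply: (@measurableT_comp _ _ _ _ _ _ (fun r : R => r^-1)); first exact: measurable_inv.
apply: measurable_funX.
by apply: measurable_funD => //; exact: measurable_powR.
Qed.

Lemma integral_bessel_weight alpha : 0 < alpha ->
  exists C : R, (\int[lebesgue_measure]_(t in `]0%R, +oo[)
    (bessel_weight alpha t / t)%:E <= C%:E)%E.
Proof.
move=> a0; exists ((alpha^-1 + (2 * alpha - alpha)^-1) * 1 `^ alpha).
apply: le_trans (integral_powR_min_le a0 _ ltr01); last by lra.
apply: ge0_le_integral => //.
- by move=> t; rewrite /= in_itv/= andbT => t0; rewrite lee_fin divr_ge0 ?bessel_weight_ge0// ltW.
- apply/measurable_EFinP; apply: measurable_funTS; apply: measurable_funM.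
    exact: measurable_bessel_weight.
  exact: measurable_inv.
- exact: measurable_powR_min.
- move=> t; rewrite /= in_itv/= andbT => t0; rewrite lee_fin powRB1E// [leRHS]mulrAC.
  by rewrite ler_pM2r ?invr_gt0// bessel_weight_le_min.
Qed.

Lemma integral_bessel_weight_min alpha beta : 0 < beta < 1 -> beta <= alpha ->
  exists C : R, forall r, 0 < r -> (\int[lebesgue_measure]_(t in `]0%R, +oo[)
    (bessel_weight alpha t / t * Num.min 1 (r / t))%:E <= (C * r `^ beta)%:E)%E.
Proof.
move=> /andP[b0 b1] ba; exists (beta^-1 + (1 - beta)^-1) => r r0.
apply: le_trans (integral_powR_min_le b0 b1 r0).
apply: ge0_le_integral => //.
- move=> t; rewrite /= in_itv/= andbT => t0; rewrite lee_fin mulr_ge0//.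
    by rewrite divr_ge0 ?bessel_weight_ge0// ltW.
  by rewrite le_min ler01 divr_ge0// ltW.
- apply/measurable_EFinP; apply: measurable_funTS; apply: measurable_funM.
    by apply: measurable_funM; [exact: measurable_bessel_weight|exact: measurable_inv].
  apply: measurable_minr => //; apply: measurable_funM => //; exact: measurable_inv.
- exact: measurable_powR_min.
- move=> t; rewrite /= in_itv/= andbT => t0; rewrite lee_fin powRB1E//.
  rewrite powRr1 ?divr_ge0 ?(ltW r0) ?(ltW t0)// ler_wpM2r//.
    by rewrite le_min ler01 divr_ge0// ltW.
  by rewrite ler_pM2r ?invr_gt0// bessel_weight_le_powR.
Qed.

End weight.

(** Meant for the factor w z, which has any sign, in front of a kernel integral that may be
    [+oo]. *)
Lemma integralZl_ge0_sign d (T : measurableType d) (R : realType)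
    (mu : {measure set T -> \bar R}) (f : T -> \bar R) (r : R) :
  measurable_fun [set: T] f -> (forall x, (0 <= f x)%E) ->
  (\int[mu]_x (r%:E * f x) = r%:E * \int[mu]_x f x)%E.
Proof.
move=> mf f0; have [r0|/ltW r0] := leP 0 r; first by rewrite ge0_integralZl.
have -> : r%:E = (- (- r)%:E)%E by rewrite EFinN oppeK.
under eq_integral do rewrite mulNe.
rewrite integral_ge0N ?ge0_integralZl ?mulNe// ?lee_fin ?oppr_ge0//.
by move=> x _; rewrite mule_ge0// lee_fin oppr_ge0.
Qed.

(** * Pointwise bounds of the potential by the maximal function *)

Section potential_estimate.
Context (R : realType) (d : measure_display) (X : metricMeasurableType R d).
Context (m : {sigma_finite_measure set X -> \bar R}) (N : R) (h : R -> R).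
Variables (alpha K : R) (w : X -> R).
Implicit Types (t r : R).
Hypotheses (hBorel : borel_sigma_algebra X) (alpha0 : 0 < alpha) (K0 : 0 < K)
  (mw : measurable_fun [set: X] w).

Local Notation s := (approx_kernel m N h).
Local Notation M := (maximal m N w).

Hypotheses (s_ge0 : forall x z t, 0 < t -> 0 <= s x z t)
  (s_measurable : forall x t, 0 < t -> measurable_fun [set: X] (fun z => s x z t))
  (s_continuous : forall x z t, 0 < t -> {for t, continuous (s x z)})
  (s_norm : forall x z t, 0 < t ->
    `|s x z t| <= K * (t `^ (- N) * (mdist x z < 4 * t)%R%:R))
  (s_diff : forall x y z t, 0 < t -> `|s x z t - s y z t| <=
    K * Num.min 1 (mdist x y / t) *
      (t `^ (- N) * (mdist x z < 4 * t)%R%:R + t `^ (- N) * (mdist y z < 4 * t)%R%:R)).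

Let XR := (X * measurableTypeR R)%type.

Let m2 : measurable_fun [set: XR] (fun q => q.2 : R).
Proof. exact: measurable_snd. Qed.

Let mw1 : measurable_fun [set: XR] (fun q => w q.1).
Proof. exact: measurableT_comp. Qed.

Let ltr0_measurable : measurable_fun [set: XR] (fun q => 0 < (q.2 : R)).
Proof. exact: measurable_fun_ltr. Qed.

Let mdist_measurable (x : X) : measurable_fun [set: X] (mdist x).
Proof.
apply: continuous_borel => //; apply: (@lipschitz_metric_continuous _ _ _ 1) => y z.
rewrite mul1r; have := metric_triangle x z y; have := metric_triangle x y z.
by rewrite (metric_sym z y) ler_norml; lra.
Qed.

Section window.
Variable b : R -> R.
Hypotheses (mb : measurable_fun [set: R] b) (b0 : forall t, 0 < t -> 0 <= b t).

Let S (x : X) (q : XR) : R := if 0 < (q.2 : R) then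
  `|w q.1| * (b q.2 * (q.2 `^ (- N) * (mdist x q.1 < 4 * q.2)%R%:R)) else 0.

Lemma window_ge0 x q : 0 <= S x q.
Proof.
rewrite /S; case: ltP => // q0; apply: mulr_ge0 => //; apply: mulr_ge0; first exact: b0.
by rewrite mulr_ge0 ?powR_ge0.
Qed.

Lemma window_measurable x : measurable_fun [set: XR] (S x).
Proof.
apply: measurable_fun_ifT => //; apply: measurable_funM; first exact: measurableT_comp.
apply: measurable_funM; first exact: (measurableT_comp mb m2).
apply: measurable_funM; first exact: (measurableT_comp (measurable_powR (- N)) m2).
have -> : (fun q : XR => (mdist x q.1 < 4 * (q.2 : R))%R%:R : R) =
    (fun q => if mdist x q.1 < 4 * (q.2 : R) then 1 else 0).
  by apply/funext => q; case: ltP.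
apply: measurable_fun_ifT => //; apply: measurable_fun_ltr; last exact: measurable_funM.
exact: (measurableT_comp (mdist_measurable x) measurable_fst).
Qed.

(** At each t, t^-N times the integral of |w| over the ball of radius 4 t about x is at most 4^N M
    x. Keeping the weight [b] general serves both the size and the difference estimate. *)
Lemma integral_window_le x : (\int[m \x lebesgue_measure]_q (S x q)%:E <=
  (4 `^ N)%:E * M x * \int[lebesgue_measure]_(t in `]0%R, +oo[) (b t)%:E)%E.
Proof.
have S0 q : (0 <= (S x q)%:E)%E by rewrite lee_fin window_ge0.
have mS : measurable_fun [set: XR] (EFin \o S x).
  by apply/measurable_EFinP; exact: window_measurable.
rewrite (@fubini_tonelli2 _ _ _ _ _ m lebesgue_measure (EFin \o S x))//.
rewrite [in leRHS](@integral_if _ (measurableTypeR R) R lebesgue_measure _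
    (fun t : R => 0 < t)); last first.
  by move=> t; rewrite /= in_itv/= andbT.
have mif : measurable_fun [set: R] (fun t : R => if 0 < t then (b t)%:E else 0%E).
  apply: measurable_fun_ifT => //; first exact: measurable_fun_ltr.
  exact/measurable_EFinP.
have if0 (t : R) : (0 <= if (0 < t)%R then (b t)%:E else 0)%E.
  by case: ltP => // t0; rewrite lee_fin b0.
have M0 : (0 <= (4 `^ N)%:E * M x)%E by rewrite mule_ge0 ?lee_fin ?powR_ge0// maximal_ge0.
rewrite -ge0_integralZl//; apply: ge0_le_integral => //.
- by move=> t _; apply: integral_ge0 => z _; exact: S0.
- exact: (measurable_fun_fubini_tonelli_G (m1 := m) (EFin \o S x)).
- exact: measurable_funeM.
- move=> t _; rewrite /fubini_G /= /S /=; case: ltP => t0; last first.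
    by rewrite integral0 mule0.
  have t40 : 0 < 4 * t by rewrite mulr_gt0.
  have bt0 : 0 <= b t * t `^ (- N) by rewrite mulr_ge0 ?powR_ge0 ?b0.
  have -> : (\int[m]_z (`|w z| * (b t * (t `^ (- N) * (mdist x z < 4 * t)%R%:R)))%:E =
      (b t * t `^ (- N))%:E * \int[m]_(z in ball x (4 * t)) `|w z|%:E)%E.
    rewrite -ge0_integralZl//; last 2 first.
    - exact: measurable_metric_ball.
    - by apply/measurable_EFinP; apply: measurable_funTS; exact: measurableT_comp.
    rewrite [RHS](@integral_if _ X R m _ (fun z => mdist x z < 4 * t)); last first.
      by move=> z; rewrite in_ball.
    apply: eq_integral => z _; rewrite -EFinM.
    case: (ltP (mdist x z) (4 * t)) => _; last by rewrite !mulr0.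
    by rewrite mulr1; congr (_%:E); ring.
  have xb : ball x (4 * t) x by rewrite in_ball mdistxx.
  apply: le_trans.
    by apply: lee_wpmul2l; [rewrite lee_fin|exact: (integral_ball_le_maximal m N w t40 xb)].
  rewrite muleA [leRHS]muleAC -!EFinM; apply: lee_wpmul2r; first exact: maximal_ge0.
  rewrite lee_fin powRM ?(ltW t0)// powRN le_eqVlt; apply/orP; left; apply/eqP.
  by field; rewrite gt_eqF// powR_gt0.
Qed.

End window.

Let integrand (x : X) (q : XR) : R := w q.1 * (alpha *
  (if 0 < (q.2 : R) then bessel_weight alpha q.2 * s x q.1 q.2 / q.2 else 0)).

Let slice_measurable x : measurable_fun [set: XR]
  (fun q => if 0 < (q.2 : R) then bessel_weight alpha q.2 * s x q.1 q.2 / q.2 else 0).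
Proof.
have -> : (fun q : XR => if 0 < (q.2 : R) then bessel_weight alpha q.2 * s x q.1 q.2 / q.2 else 0) =
  (fun q => bessel_weight alpha q.2 * (if 0 < (q.2 : R) then s x q.1 q.2 else 0) / q.2).
  by apply/funext => q; case: ltP => // _; rewrite mulr0 mul0r.
apply: measurable_funM; last first.
  by apply: (@measurableT_comp _ _ _ _ _ _ (fun r : R => r^-1)) => //; exact: measurable_inv.
apply: measurable_funM; first exact: (measurableT_comp (measurable_bessel_weight alpha) m2).
by apply: measurable_caratheodory => [t t0|z t t0]; [exact: s_measurable|exact: s_continuous].
Qed.

Let integrand_measurable x : measurable_fun [set: XR] (integrand x).
Proof. by apply: measurable_funM => //; apply: measurable_funM. Qed.

Let slice_ge0 x z t :
  0 <= if 0 < t then bessel_weight alpha t * s x z t / t else 0.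
Proof.
case: ltP => // t0; apply: divr_ge0; last exact: ltW.
by apply: mulr_ge0; [exact: bessel_weight_ge0|exact: s_ge0].
Qed.

(** For fixed z the integrand in t is a nonnegative function times the constant w z * alpha, so the
    constant moves inside even where the kernel is [+oo]. *)
Lemma bessel_potentialE x : bessel_potential m N h alpha w x =
  (\int[m]_z \int[lebesgue_measure]_t (integrand x (z, t))%:E)%E.
Proof.
apply: eq_integral => z _; rewrite /bessel_kernel.
rewrite (@integral_if _ (measurableTypeR R) R lebesgue_measure _
    (fun t : R => 0 < t)); last first.
  by move=> t; rewrite /= in_itv/= andbT.
have mz : measurable_fun [set: measurableTypeR R] (fun t : measurableTypeR R =>
    (if 0 < (t : R) then bessel_weight alpha t * s x z t / t else 0)%:E).
  apply/measurable_EFinP.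
  exact: (measurableT_comp (slice_measurable x) (pair1_measurable z)).
rewrite muleA -EFinM.
transitivity ((w z * alpha)%:E * \int[lebesgue_measure]_(t in [set: measurableTypeR R])
    (if 0 < (t : R) then bessel_weight alpha t * s x z t / t else 0)%:E)%E.
  by congr (_ * _)%E; apply: eq_integral => t _; case: ltP.
rewrite -integralZl_ge0_sign//; last by move=> t; rewrite lee_fin slice_ge0.
by apply: eq_integral => t _; rewrite -EFinM /integrand/= mulrA.
Qed.

Let aK0 : 0 <= alpha * K.
Proof. by rewrite mulr_ge0 ?(ltW alpha0) ?(ltW K0). Qed.

Let weight_div_ge0 t : 0 < t -> 0 <= bessel_weight alpha t / t.
Proof. by move=> t0; rewrite divr_ge0 ?bessel_weight_ge0 ?(ltW t0). Qed.

Let b1 t := alpha * K * (bessel_weight alpha t / t).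

Let b1_ge0 t : 0 < t -> 0 <= b1 t.
Proof. by move=> t0; rewrite mulr_ge0// weight_div_ge0. Qed.

Let b1_measurable : measurable_fun [set: R] b1.
Proof.
apply: measurable_funM => //; apply: measurable_funM; last exact: measurable_inv.
exact: measurable_bessel_weight.
Qed.

Let S b (x : X) (q : XR) : R := if 0 < (q.2 : R) then
  `|w q.1| * (b q.2 * (q.2 `^ (- N) * (mdist x q.1 < 4 * q.2)%R%:R)) else 0.

Let integrand_norm x q : `|integrand x q| <= S b1 x q.
Proof.
rewrite /integrand /S; case: ltP => [q0|_]; last by rewrite !mulr0 normr0.
have c0 : 0 <= alpha * (bessel_weight alpha q.2 / q.2).
  by rewrite mulr_ge0 ?weight_div_ge0 ?(ltW alpha0).
rewrite normrM ler_wpM2l//.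
rewrite (_ : alpha * (bessel_weight alpha q.2 * s x q.1 q.2 / q.2) =
  alpha * (bessel_weight alpha q.2 / q.2) * s x q.1 q.2); last by ring.
rewrite normrM (ger0_norm c0).
have := ler_wpM2l c0 (s_norm x q.1 q0); rewrite /b1.
by move=> /le_trans; apply; rewrite le_eqVlt; apply/orP; left; apply/eqP; ring.
Qed.

Let b2 r t := alpha * K * (bessel_weight alpha t / t * Num.min 1 (r / t)).

Let min_ge0 r t : 0 <= r -> 0 < t -> 0 <= Num.min 1 (r / t).
Proof. by move=> r0 t0; rewrite le_min ler01 divr_ge0// ltW. Qed.

Let b2_ge0 r t : 0 <= r -> 0 < t -> 0 <= b2 r t.
Proof.
by move=> r0 t0; apply: mulr_ge0 => //; rewrite mulr_ge0 ?weight_div_ge0 ?min_ge0.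
Qed.

Let b2_measurable r : measurable_fun [set: R] (b2 r).
Proof.
apply: measurable_funM => //; apply: measurable_funM.
  by apply: measurable_funM; [exact: measurable_bessel_weight|exact: measurable_inv].
by apply: measurable_minr => //; apply: measurable_funM => //; exact: measurable_inv.
Qed.

Let integrand_diff x y q :
  `|integrand x q - integrand y q| <= S (b2 (mdist x y)) x q + S (b2 (mdist x y)) y q.
Proof.
rewrite /integrand /S -mulrBr; case: ltP => [q0|_]; last by rewrite subrr mulr0 normr0 addr0.
have c0 : 0 <= alpha * (bessel_weight alpha q.2 / q.2).
  by rewrite mulr_ge0 ?weight_div_ge0 ?(ltW alpha0).
rewrite normrM -mulrDr ler_wpM2l//.
rewrite (_ : alpha * (bessel_weight alpha q.2 * s x q.1 q.2 / q.2) -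
  alpha * (bessel_weight alpha q.2 * s y q.1 q.2 / q.2) =
  alpha * (bessel_weight alpha q.2 / q.2) * (s x q.1 q.2 - s y q.1 q.2)); last by ring.
rewrite normrM (ger0_norm c0).
have := ler_wpM2l c0 (s_diff x y q.1 q0); rewrite /b2.
by move=> /le_trans; apply; rewrite le_eqVlt; apply/orP; left; apply/eqP; ring.
Qed.

(** The integrability part licenses Fubini at every point where the maximal function is finite. *)
Lemma bessel_potential_bound (C : R) (x : X) :
  (\int[lebesgue_measure]_(t in `]0%R, +oo[) (bessel_weight alpha t / t)%:E <= C%:E)%E ->
  (M x < +oo)%E ->
  (m \x lebesgue_measure)%E.-integrable [set: XR] (EFin \o integrand x) /\
  (\int[m \x lebesgue_measure]_q `|integrand x q|%:E <=
    (4 `^ N * (alpha * K * C) * fine (M x))%:E)%E.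
Proof.
move=> hC Mx; have Mfin : M x \is a fin_num by rewrite ge0_fin_numE// maximal_ge0.
have le : (\int[m \x lebesgue_measure]_q `|integrand x q|%:E <=
    (4 `^ N * (alpha * K * C) * fine (M x))%:E)%E.
  apply: (@le_trans _ _ (\int[m \x lebesgue_measure]_q (S b1 x q)%:E)%E).
    apply: ge0_le_integral => //.
    - by apply/measurable_EFinP; apply: measurableT_comp => //; exact: integrand_measurable.
    - by apply/measurable_EFinP; exact: window_measurable.
    - by move=> q _; rewrite lee_fin.
  apply: (le_trans (integral_window_le _ _ _)) => //.
  rewrite -[X in ((_ * X) * _)%E]fineK// -EFinM [in leRHS]mulrAC (EFinM (_ * _)).
  apply: lee_wpmul2l.
    by rewrite lee_fin mulr_ge0 ?powR_ge0// fine_ge0// maximal_ge0.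
  under eq_integral do rewrite EFinM.
  rewrite ge0_integralZl//; last 2 first.
  - apply/measurable_EFinP; apply: measurable_funTS; apply: measurable_funM.
      exact: measurable_bessel_weight.
    exact: measurable_inv.
  - move=> t; rewrite /= in_itv/= andbT => t0.
    by rewrite lee_fin divr_ge0 ?bessel_weight_ge0// ltW.
  by rewrite (EFinM (alpha * K)); apply: lee_wpmul2l.
split => //; apply/integrableP; split.
  by apply/measurable_EFinP; exact: integrand_measurable.
by apply: (le_lt_trans le); rewrite ltry.
Qed.

Lemma bessel_potential_fin (C : R) (x : X) :
  (\int[lebesgue_measure]_(t in `]0%R, +oo[) (bessel_weight alpha t / t)%:E <= C%:E)%E ->
  (M x < +oo)%E ->
  (`|bessel_potential m N h alpha w x| <=
    (4 `^ N * (alpha * K * C) * fine (M x))%:E)%E.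
Proof.
move=> hC Mx; have [ix le] := bessel_potential_bound hC Mx.
have -> : bessel_potential m N h alpha w x =
    (\int[m \x lebesgue_measure]_q (integrand x q)%:E)%E.
  by rewrite bessel_potentialE; exact: (integral12_prod_meas1 ix).
apply: le_trans le; apply: le_abse_integral => //.
by apply/measurable_EFinP; exact: integrand_measurable.
Qed.

(** Both integrands are integrable on the product, so they can be subtracted at each (z, t), where
    the gain min(1, d(x, y) / t) is visible. *)
Lemma bessel_potential_diff (C C' beta : R) (x y : X) :
  (\int[lebesgue_measure]_(t in `]0%R, +oo[) (bessel_weight alpha t / t)%:E <= C%:E)%E ->
  (forall r, 0 < r -> (\int[lebesgue_measure]_(t in `]0%R, +oo[)
    (bessel_weight alpha t / t * Num.min 1 (r / t))%:E <= (C' * r `^ beta)%:E)%E) ->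
  (M x < +oo)%E -> (M y < +oo)%E -> x != y ->
  (`|bessel_potential m N h alpha w x - bessel_potential m N h alpha w y| <=
    (4 `^ N * (alpha * K * C') * (mdist x y `^ beta * (fine (M x) + fine (M y))))%:E)%E.
Proof.
move=> hC hC' Mx My xy; have dxy : 0 < mdist x y by rewrite mdist_gt0.
have [ix _] := bessel_potential_bound hC Mx.
have [iy _] := bessel_potential_bound hC My.
have E z : (M z < +oo)%E -> bessel_potential m N h alpha w z =
    (\int[m \x lebesgue_measure]_q (integrand z q)%:E)%E.
  move=> /(bessel_potential_bound hC)[iz _].
  by rewrite bessel_potentialE; exact: (integral12_prod_meas1 iz).
rewrite !E//.
rewrite -integralB_EFin//.
have mS z := window_measurable (b2_measurable (mdist x y)) z.
have S0 z q := window_ge0 (fun t => b2_ge0 (ltW dxy) (t := t)) z q.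
have Sle z : (M z < +oo)%E -> (\int[m \x lebesgue_measure]_q (S (b2 (mdist x y)) z q)%:E <=
    (4 `^ N * (alpha * K * C') * (mdist x y `^ beta * fine (M z)))%:E)%E.
  move=> Mz; have Mfin : M z \is a fin_num by rewrite ge0_fin_numE// maximal_ge0.
  apply: (le_trans (integral_window_le (b2_measurable (mdist x y))
    (fun t => b2_ge0 (ltW dxy) (t := t)) z)).
  have -> : 4 `^ N * (alpha * K * C') * (mdist x y `^ beta * fine (M z)) =
    (4 `^ N * fine (M z)) * (alpha * K * (C' * mdist x y `^ beta)) by ring.
  rewrite -[X in ((_ * X) * _)%E]fineK// -EFinM (EFinM (_ * _)); apply: lee_wpmul2l.
    by rewrite lee_fin mulr_ge0 ?powR_ge0// fine_ge0// maximal_ge0.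
  under eq_integral do rewrite EFinM.
  rewrite ge0_integralZl//; last 2 first.
  - apply/measurable_EFinP; apply: measurable_funTS; apply: measurable_funM.
      apply: measurable_funM; first exact: measurable_bessel_weight.
      exact: measurable_inv.
    by apply: measurable_minr => //; apply: measurable_funM => //; exact: measurable_inv.
  - move=> t; rewrite /= in_itv/= andbT => t0.
    by rewrite lee_fin mulr_ge0 ?min_ge0 ?(ltW dxy)// divr_ge0 ?bessel_weight_ge0// ltW.
  by rewrite (EFinM (alpha * K)); apply: lee_wpmul2l; [rewrite lee_fin|exact: hC'].
rewrite !mulrDr EFinD; apply: le_trans (leeD (Sle x Mx) (Sle y My)).
rewrite -ge0_integralD//; last 4 first.
- by move=> q _; rewrite lee_fin; exact: S0.
- by apply/measurable_EFinP; exact: mS.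
- by move=> q _; rewrite lee_fin; exact: S0.
- by apply/measurable_EFinP; exact: mS.
apply: le_trans.
  apply: le_abse_integral => //; apply: emeasurable_funB.
    by apply/measurable_EFinP; exact: integrand_measurable.
  by apply/measurable_EFinP; exact: integrand_measurable.
apply: ge0_le_integral => //.
- apply: measurableT_comp => //; apply: emeasurable_funB.
    by apply/measurable_EFinP; exact: integrand_measurable.
  by apply/measurable_EFinP; exact: integrand_measurable.
- by apply: emeasurable_funD; apply/measurable_EFinP; exact: mS.
- by move=> q _; rewrite /= -EFinD lee_fin; exact: integrand_diff.
Qed.

End potential_estimate.

(** * The embedding *)

Section Lp_norm.
Context d (T : measurableType d) (R : realType) (mu : {measure set T -> \bar R}) (p : R).
Hypothesis hp : 0 < p.
Local Open Scope ereal_scope.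

Lemma Lnorm_le (C : R) (f g : T -> R) : (0 <= C)%R ->
  \int[mu]_x (`|f x| `^ p)%:E <= (C `^ p)%:E * \int[mu]_x (`|g x| `^ p)%:E ->
  'N[mu]_(p%:E)[EFin \o f] <= C%:E * 'N[mu]_(p%:E)[EFin \o g].
Proof.
move=> C0 fg; rewrite unlock /Lnorm.
have If0 (f' : T -> R) : 0 <= \int[mu]_x (`|f' x| `^ p)%:E.
  by apply: integral_ge0 => x _; rewrite lee_fin powR_ge0.
have -> : C%:E = (C `^ p)%:E `^ p^-1.
  by rewrite poweR_EFin -powRrM mulfV ?gt_eqF// powRr1.
rewrite -poweRM ?lee_fin ?powR_ge0//; last exact: If0.
apply: gt0_ler_poweR => //; first by rewrite invr_ge0 ltW.
- by rewrite in_itv/= leey andbT; exact: If0.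
- by rewrite in_itv/= leey andbT mule_ge0 ?lee_fin ?powR_ge0//; exact: If0.
Qed.

Lemma Lnorm_lty_integral (f : T -> R) : 'N[mu]_(p%:E)[EFin \o f] < +oo ->
  \int[mu]_x (`|f x| `^ p)%:E < +oo.
Proof.
move=> /(poweR_lty p); rewrite poweR_Lnorm ?gt_eqF//.
Qed.

Lemma Lfun_in (f : T -> R) : measurable_fun [set: T] f ->
  'N[mu]_(p%:E)[EFin \o f] < +oo -> f \in Lfun mu p%:E.
Proof. by move=> mf nf; rewrite inE; apply/andP; split; rewrite inE. Qed.

Lemma Lfun_measurable (f : T -> R) : f \in Lfun mu p%:E -> measurable_fun [set: T] f.
Proof. by move=> /sub_Lfun_mfun; rewrite inE. Qed.

Lemma Lfun_lty (f : T -> R) : f \in Lfun mu p%:E -> 'N[mu]_(p%:E)[EFin \o f] < +oo.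
Proof. by move=> /sub_Lfun_finLfun; rewrite inE. Qed.

End Lp_norm.

Section embedding.
Context (R : realType) (d : measure_display) (X : metricMeasurableType R d).
Context (m : {sigma_finite_measure set X -> \bar R}).
Variables (N c : R) (h : R -> R) (p alpha beta : R).
Hypotheses (hBorel : borel_sigma_algebra X) (hN : 0 < N) (hc : 0 < c)
  (hAhlfors : ahlfors_regular m N c) (hh : cutoff h) (hp : 1 < p)
  (halpha : 0 < alpha) (hbeta : 0 < beta < 1) (hba : beta <= alpha).

Let p0 : 0 < p. Proof. exact: lt_trans hp. Qed.

(** The constant is chosen before [u] and [w]; this uniformity is what turns the inclusion into a
    continuous one. *)
Lemma potential_hajlasz_gradient : exists2 C : R, 0 < C &
  forall u w : X -> R, measurable_fun [set: X] u -> potential_of m N h alpha p u w ->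
    u \in Lfun m p%:E /\
    exists2 g, hajlasz_gradient m beta u g & g \in Lfun m p%:E /\
      ('N[m]_(p%:E)[EFin \o g] <= C%:E * 'N[m]_(p%:E)[EFin \o w])%E.
Proof.
have [L L0 hLip] := cutoff_lipschitz hh.
have [K K0 [s_norm s_diff]] := approx_kernel_bounds hBorel hc hAhlfors hh L0 hLip.
have s_ge0 := approx_kernel_ge0 hBorel hc hAhlfors hh L0 hLip.
have s_meas := approx_kernel_measurable hBorel hc hAhlfors hh L0 hLip.
have s_cont x z t := @approx_kernel_continuous _ _ _ _ _ _ _ _ hBorel hc hAhlfors hh L0 hLip x z t.
have [C1 hC1] := integral_bessel_weight halpha.
have [C2 hC2] := integral_bessel_weight_min hbeta hba.
have C10 : 0 <= C1.
  rewrite -lee_fin; apply: le_trans hC1; apply: integral_ge0 => t.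
  rewrite /= in_itv/= andbT => t0.
  by rewrite lee_fin divr_ge0 ?bessel_weight_ge0// ltW.
have C20 : 0 <= C2.
  have := hC2 1 ltr01; rewrite powR1 mulr1 -lee_fin; apply: le_trans.
  apply: integral_ge0 => t; rewrite /= in_itv/= andbT => t0.
  rewrite lee_fin mulr_ge0//; first by rewrite divr_ge0 ?bessel_weight_ge0// ltW.
  by rewrite le_min ler01 divr_ge0// ltW.
pose K1 := 4 `^ N * (alpha * K * C1); pose K2 := 4 `^ N * (alpha * K * C2).
have aK : 0 <= alpha * K by rewrite mulr_ge0 ?(ltW halpha) ?(ltW K0).
have K10 : 0 <= K1 by rewrite mulr_ge0 ?powR_ge0// mulr_ge0.
have K20 : 0 <= K2 by rewrite mulr_ge0 ?powR_ge0// mulr_ge0.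
have [C3 C30 hC3] : exists2 C3 : R, 0 <= C3 & forall w : X -> R, measurable_fun [set: X] w ->
    ((\int[m]_x (`|w x| `^ p)%:E < +oo)%E -> {ae m, forall x, (maximal m N w x < +oo)%E}) /\
    (\int[m]_x (fine (maximal m N w x) `^ p)%:E <=
      C3%:E * \int[m]_x (`|w x| `^ p)%:E)%E.
  eexists; last by move=> w mw; exact: (maximal_strong hBorel hN hc hAhlfors hp mw).
  rewrite mulr_ge0 ?(ltW p0)// divr_ge0 ?subr_ge0 ?(ltW hp)//.
  by rewrite mulr_ge0 ?powR_ge0// mulr_ge0 ?powR_ge0// mulr_ge0// ltW.
pose C := (K1 + K2) * C3 `^ p^-1.
have C0 : 0 <= C by rewrite mulr_ge0 ?powR_ge0// addr_ge0.
exists (C + 1); first by rewrite ltr_wpDl.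
move=> u w mu [/[dup] /Lfun_measurable mw /Lfun_lty wlty uw].
have wint := Lnorm_lty_integral p0 wlty.
have [/(_ wint) Mlty Mint] := hC3 w mw.
(* The K1 part dominates |u| and puts [u] in L^p; the K2 part gives the gradient inequality. *)
pose g x := (K1 + K2) * fine (maximal m N w x).
have fM0 x : 0 <= fine (maximal m N w x) by rewrite fine_ge0// maximal_ge0.
have g0 x : 0 <= g x by rewrite mulr_ge0// addr_ge0.
have mg : measurable_fun [set: X] g.
  apply: measurable_funM => //; apply: measurableT_comp => //.
  exact: measurable_maximal.
have gint : (\int[m]_x (`|g x| `^ p)%:E <= (C `^ p)%:E * \int[m]_x (`|w x| `^ p)%:E)%E.
  have -> : C `^ p = (K1 + K2) `^ p * C3.
    by rewrite powRM ?addr_ge0 ?powR_ge0// -powRrM mulVf ?gt_eqF// powRr1.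
  rewrite EFinM -muleA; apply: (@le_trans _ _ (((K1 + K2) `^ p)%:E *
      \int[m]_x (fine (maximal m N w x) `^ p)%:E)%E).
    rewrite -ge0_integralZl ?lee_fin ?powR_ge0//; last 2 first.
    - apply/measurable_EFinP; apply: (measurableT_comp (measurable_powR _)).
      by apply: measurableT_comp => //; exact: measurable_maximal.
    - by move=> x _; rewrite lee_fin powR_ge0.
    rewrite le_eqVlt; apply/orP; left; apply/eqP; apply: eq_integral => x _.
    by rewrite ger0_norm// powRM ?addr_ge0// EFinM.
  by apply: lee_wpmul2l => //; rewrite lee_fin powR_ge0.
have Ng : ('N[m]_(p%:E)[EFin \o g] <= C%:E * 'N[m]_(p%:E)[EFin \o w])%E.
  exact: Lnorm_le.
have glty : ('N[m]_(p%:E)[EFin \o g] < +oo)%E.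
  by apply: (le_lt_trans Ng); rewrite lte_mul_pinfty ?lee_fin.
have good : {ae m, forall x, (maximal m N w x < +oo)%E /\
    bessel_potential m N h alpha w x = (u x)%:E}.
  by apply: filterS2 Mlty uw => x.
have ug : {ae m, forall x, `|u x| <= g x}.
  apply: filterS good => x [Mx ux].
  have := bessel_potential_fin hBorel halpha K0 mw s_ge0 s_meas s_cont s_norm hC1 Mx.
  rewrite ux lee_fin => /le_trans; apply.
  by rewrite ler_wpM2r// lerDl.
split.
  apply: Lfun_in => //; apply: le_lt_trans glty.
  rewrite -['N[m]_(p%:E)[EFin \o g]%E]mul1e; apply: (Lnorm_le p0 ler01).
  have -> : 1 `^ p = 1 by rewrite powR1.
  rewrite mul1e; apply: ae_ge0_le_integral => //.
  - apply/measurable_EFinP; apply: (measurableT_comp (measurable_powR _)).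
    exact: measurableT_comp.
  - apply/measurable_EFinP; apply: (measurableT_comp (measurable_powR _)).
    exact: measurableT_comp.
  - apply: filterS ug => x ugx _; rewrite lee_fin.
    by apply: ge0_ler_powR; rewrite ?nnegrE ?(ltW p0)// (ger0_norm (g0 x)).
exists g; last first.
  split; first exact: Lfun_in.
  apply: (le_trans Ng); apply: lee_wpmul2r; first exact: Lnorm_ge0.
  by rewrite lee_fin lerDl.
split => //; exists (~` [set x | (maximal m N w x < +oo)%E /\
    bessel_potential m N h alpha w x = (u x)%:E]); first exact: good.
move=> x y /contrapT[Mx ux] /contrapT[My uy].
(* The difference estimate asks for a positive distance. *)
have [<-|xy] := eqVneq x y.
  by rewrite subrr normr0 mulr_ge0 ?powR_ge0// addr_ge0.
have := bessel_potential_diff hBorel halpha K0 mw s_ge0 s_meas s_cont s_norm s_diff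
  hC1 hC2 Mx My xy.
rewrite ux uy -EFinB lee_fin => /le_trans; apply.
rewrite /g -mulrDr [leRHS]mulrCA ler_wpM2r//.
  by rewrite mulr_ge0 ?powR_ge0// addr_ge0.
by rewrite lerDr.
Qed.

Lemma potential_hajlasz_embedding : continuously_embedded
  (potential_space m N h alpha p) (potential_norm m N h alpha p)
  (hajlasz_space m beta p) (hajlasz_norm m beta p).
Proof.
have [C C0 HC] := potential_hajlasz_gradient.
split=> [f [mf [w fw]]|f [mf _] e e0].
  have [fL [g fg [gL _]]] := HC f w mf fw.
  by split => //; exists g.
(* The Hajlasz norm of the difference is below delta + C * delta, which is e. *)
exists (e / (1 + C)); first by rewrite divr_gt0// ltr_pwDl// ltW.
move=> g [mg _]; set u := fun x => g x - f x => ud.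
have mu : measurable_fun [set: X] u by exact: measurable_funB.
pose Inf := ereal_inf [set 'N[m]_(p%:E)[EFin \o w]%E | w in potential_of m N h alpha p u].
have Nu0 : (0 <= 'N[m]_(p%:E)[EFin \o u])%E by exact: Lnorm_ge0.
have Inf0 : (0 <= Inf)%E by apply: le_ereal_inf_tmp => _ [w _ <-]; exact: Lnorm_ge0.
have Nud : ('N[m]_(p%:E)[EFin \o u] < (e / (1 + C))%:E)%E.
  by apply: le_lt_trans ud; rewrite leeDl.
have : (Inf < (e / (1 + C))%:E)%E by apply: le_lt_trans ud; rewrite leeDr.
(* The infimum of the empty set is [+oo], so a value below delta itself provides a [w] whose
   potential is the difference [u], and the gradient bound applies directly to [u]. *)
move=> /ereal_inf_lt[_ [w uw <-] wd].
have [_ [G uG [_ GN]]] := HC u w mu uw.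
rewrite /hajlasz_norm (_ : e = e / (1 + C) + C * (e / (1 + C))); last first.
  by field; rewrite gt_eqF// ltr_pwDl// ltW.
rewrite EFinD; apply: lte_leD => //.
  rewrite ge0_fin_numE; last by apply: le_ereal_inf_tmp => _ [? _ <-]; exact: Lnorm_ge0.
  apply: (@le_lt_trans _ _ 'N[m]_(p%:E)[EFin \o G]%E); first by apply: ereal_inf_lbound; exists G.
  apply: (le_lt_trans GN); rewrite lte_mul_pinfty ?lee_fin ?(ltW C0)//.
  exact: lt_trans wd (ltry _).
apply: (@le_trans _ _ 'N[m]_(p%:E)[EFin \o G]%E); first by apply: ereal_inf_lbound; exists G.
apply: (le_trans GN); rewrite EFinM; apply: lee_wpmul2l; first by rewrite lee_fin ltW.
exact: ltW.
Qed.

End embedding.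

(** Fubini asks for the sigma-finite structure. Balls of integer radius about one point exhaust X
    and have finite measure; an empty X is treated apart. *)
Lemma ahlfors_sigma_finite (R : realType) (d : measure_display)
    (X : metricMeasurableType R d) (m : {measure set X -> \bar R}) (N c : R) :
  borel_sigma_algebra X -> ahlfors_regular m N c ->
  exists m' : {sigma_finite_measure set X -> \bar R}, m' = m :> {measure set X -> \bar R}.
Proof.
move=> hBorel hAhlfors.
have sf : sigma_finite [set: X] m.
  have [[x _]|/forallNP X0] := pselect (exists x : X, True); last first.
    exists (fun=> set0); last by move=> _; rewrite measure0.
    by apply/seteqP; split => // x _; have := X0 x.
  exists (fun n => ball x n.+1%:R); last first.
    move=> n; split; first exact: measurable_metric_ball.
    by have /andP[_ /le_lt_trans] := hAhlfors x n.+1%:R (ltr0Sn _ n); apply; rewrite ltry.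
  apply/seteqP; split => // y _; exists (Num.truncn (mdist x y)) => //=.
  by rewrite in_ball truncnS_gt.
pose H1 := isSFinite.Build _ _ _ _ (sfinite_measure_sigma_finite sf).
pose H2 := isSigmaFinite.Build _ _ _ _ sf.
pose m' := HB.pack_for {sigma_finite_measure set X -> \bar R} (Measure.sort m) H1 H2.
by exists m'; exact: eq_measure.
Qed.

Theorem corollary4p4 (R : realType) (d : measure_display)
  (X : metricMeasurableType R d) (m : {measure set X -> \bar R})
  (N c : R) (h : R -> R) (p alpha : R)
  (hBorel : borel_sigma_algebra X)
  (hinfty : m [set: X] = +oo%E)
  (hN : 0 < N) (hc : 0 < c)
  (hAhlfors : ahlfors_regular m N c)
  (hh : cutoff h)
  (hp : 1 < p) (halpha : 0 < alpha) :
  (alpha < 1 ->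
     continuously_embedded
       (potential_space m N h alpha p) (potential_norm m N h alpha p)
       (hajlasz_space m alpha p) (hajlasz_norm m alpha p)) /\
  (1 <= alpha -> forall beta : R, 0 < beta < 1 ->
     continuously_embedded
       (potential_space m N h alpha p) (potential_norm m N h alpha p)
       (hajlasz_space m beta p) (hajlasz_norm m beta p)).
Proof.
have [m' m'E] := ahlfors_sigma_finite hBorel hAhlfors; subst m.
(* The first half is the case beta = alpha; in the second, beta < 1 <= alpha. *)
split=> [alpha1|alpha1 beta /andP[beta0 beta1]];
  apply: (potential_hajlasz_embedding hBorel hN hc hAhlfors hh hp halpha) => //.
- by rewrite halpha.
- by rewrite beta0.
- exact: ltW (lt_le_trans beta1 alpha1).
Qed.
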